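(* Let $p,q,r$ satisfy either $1\le p\le q\le r\le 2$, or $1\le p\le 2\le r\le\infty$ and $q=2$. Then the spaces $\ell_p^n\otimes_\pi\ell_q^n\otimes_\pi\ell_r^n$ allow a nearly Euclidean decomposition of Kashin type: there is a constant $C$ depending only on $p,q,r$ such that for every $n\in\mathbb{N}$, writing $N=n^3$, there exist two subspaces $E,F$ of $\ell_p^n\otimes_\pi\ell_q^n\otimes_\pi\ell_r^n\cong\mathbb{R}^{N}$, orthogonal to each other with respect to the standard inner product, with $\dim E=\lfloor N/2\rfloor$ and $\dim F=\lceil N/2\rceil$, such that the Banach-Mazur distances from $E$ to $\ell_2^{\dim E}$ and from $F$ to $\ell_2^{\dim F}$ are at most $C$ (where $E$, $F$ carry the norm induced from $\ell_p^n\otimes_\pi\ell_q^n\otimes_\pi\ell_r^n$).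
   Context: All spaces are real. $\ell_p^n$ is $\mathbb{R}^n$ with the $\ell_p$-norm. The space $\ell_p^n\otimes_\pi\ell_q^n\otimes_\pi\ell_r^n$ is $\mathbb{R}^n\otimes\mathbb{R}^n\otimes\mathbb{R}^n\cong\mathbb{R}^{n^3}$ (identified via the basis $e_i\otimes e_j\otimes e_k$, which is orthonormal for the standard inner product) with the projective norm $\|A\|_\pi=\inf\{\sum_{l=1}^m\|x_l\|_p\|y_l\|_q\|z_l\|_r: m\in\mathbb{N},\ A=\sum_{l=1}^m x_l\otimes y_l\otimes z_l\}$. The Banach-Mazur distance between two isomorphic spaces is $\inf\|T\|\,\|T^{-1}\|$ over all linear isomorphisms $T$ between them (taken to be $1$ for zero-dimensional spaces). *)

(* Defs.v *)
From mathcomp Require Import all_boot all_order all_algebra.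
From mathcomp Require Import all_classical all_reals all_analysis.

Set Implicit Arguments.
Unset Strict Implicit.
Unset Printing Implicit Defensive.

Import Order.TTheory GRing.Theory Num.Theory.

Local Open Scope classical_set_scope.
Local Open Scope ring_scope.

(* The norm of ell_p^n for 1 <= p <= +oo; the value at p = -oo is a dummy. *)
Definition lpnorm (R : realType) (n : nat) (p : \bar R) (x : 'rV[R]_n) : R :=
  match p with
  | s%:E => (\sum_(i < n) `|x 0 i| `^ s) `^ s^-1
  | +oo%E => \big[Num.max/0]_(i < n) `|x 0 i|
  | -oo%E => 0
  end.

(* R^n (x) R^n (x) R^n as arrays of coordinates in the basis e_i (x) e_j (x) e_k;
   entries are in R^o because the vector space structure of finite functions
   requires values in a vector space. *)
Notation tensor3 R n := {ffun 'I_n * 'I_n * 'I_n -> R^o}.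

Definition elem_tensor (R : realType) (n : nat) (x y z : 'rV[R]_n) :
    tensor3 R n :=
  [ffun t => x 0 t.1.1 * y 0 t.1.2 * z 0 t.2].

Definition tensor_dot (R : realType) (n : nat) (A B : tensor3 R n) : R :=
  \sum_t A t * B t.

(* The infimum is over a nonempty set of nonnegative reals. *)
Definition projnorm (R : realType) (n : nat) (p q r : \bar R)
    (A : tensor3 R n) : R :=
  inf [set c : R | exists (m : nat) (x y z : 'I_m -> 'rV[R]_n),
         A = \sum_(l < m) elem_tensor (x l) (y l) (z l)
         /\ c = \sum_(l < m)
                  lpnorm p (x l) * lpnorm q (y l) * lpnorm r (z l)].

(* Norms are passed explicitly as functions, so that one vector space can carry
   several of them. *)
Definition opnorm (R : realType) (U W : vectType R) (NU : U -> R) (NW : W -> R)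
    (T : 'Hom(U, W)) : \bar R :=
  ereal_sup [set (NW (T u))%:E | u in [set u | NU u <= 1]].

(* [T^-1%VF] is the two-sided inverse of [T] since [T] is bijective. *)
Definition banach_mazur (R : realType) (U W : vectType R)
    (NU : U -> R) (NW : W -> R) : \bar R :=
  if \dim {:U} == 0%N then 1%E
  else ereal_inf [set (opnorm NU NW T * opnorm NW NU T^-1%VF)%E
                    | T in [set T : 'Hom(U, W) | bijective T]].

Definition dist_to_euclidean (R : realType) (n : nat) (p q r : \bar R)
    (E : {vspace tensor3 R n}) : \bar R :=
  @banach_mazur R (subvs_of E) 'rV[R]_(\dim E)
    (fun u => projnorm p q r (vsval u)) (lpnorm 2%:E).

(* Main.v *)
Require Import Defs.
From HB Require Import structures.
From mathcomp Require Import all_boot all_order all_algebra.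
From mathcomp Require Import all_classical all_reals all_analysis.
From mathcomp Require Import ring lra.

Import Order.TTheory GRing.Theory Num.Theory.
Local Open Scope ring_scope.

(** Write $N = n^3$, let $\pi$ be the projective norm and $|\cdot|$ the
    Euclidean norm on $\mathbb{R}^N$. In both ranges of the exponents there is
    $\rho$ with

    - $\pi \le \rho |\cdot|$ (lemmas [projnorm_le_fibres] and
      [projnorm_le_signs], by explicit representations of a tensor), and
    - an average sign tensor has dual (injective) norm $O(\sqrt N / \rho)$
      (lemmas [random_dual_le2] and [random_dual_ge2]). On $\ell_2$ this is a
      net argument ([random_trilinear]); for exponents below $2$ it follows from
      a discrete form of Riesz-Thorin interpolation ([interpolation]).

    The second property bounds the number of integer points of dilates of the
    unit ball of $\pi$: an integer vector $z$ with
    $\langle s, z \rangle \le M(s)$ for all sign vectors $s$ belongs to a set of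
    at most $4^N \exp(\mathrm{avg}\, M)$ elements ([card_integer_points]), by a
    sum of $\exp(- \max_s (\langle s, z \rangle - M(s)))$ computed one
    coordinate at a time. So the unit ball of $\pi$ is covered by $e^{O(N)}$
    Euclidean balls of radius of order $1 / \rho$.

    The two subspaces are $E = \{(a, aG)\}$ and its orthogonal complement
    $F = \{(-Gb, b)\}$ for a random matrix $G$ of bounded operator norm. A given
    unit vector is close to $E$ or to $F$ with probability at most $\epsilon^N$, where
    $\epsilon$ is as small as desired; a union bound over the centres of the
    balls gives $G$ for which no centre far from $0$ is close to $E$ or $F$
    ([random_matrix]). Hence $\pi \ge c \rho |\cdot|$ on both subspaces
    ([kashin_core]), and projecting the graphs to their parameter spaces gives
    isomorphisms with Euclidean spaces ([dist_le], [kashin_tensor]). All the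
    probability is finite: averages over signs and over finitely many
    multipliers. *)

Set Implicit Arguments.
Unset Strict Implicit.
Unset Printing Implicit Defensive.

(** * Averages over finite types *)

(** The uniform average of a real function on a finite type. *)
Definition avg (R : realType) (X : finType) (f : X -> R) : R :=
  (\sum_x f x) / #|X|%:R.

(** The sign $-1$ for [true] and $+1$ for [false]. *)
Definition sg (R : realType) (b : bool) : R := (-1) ^+ b.

(** Prepending a value to a finite function on ['I_N]. *)
Definition fcons (X : finType) (N : nat) (x : X) (g : {ffun 'I_N -> X}) :
    {ffun 'I_N.+1 -> X} :=
  [ffun i => oapp g x (unlift ord0 i)].

Section Averages.
Context {R : realType}.
Implicit Types X Y : finType.

Lemma avg_eq X (f g : X -> R) : f =1 g -> avg f = avg g.
Proof. by move=> fg; rewrite /avg (eq_bigr g). Qed.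

Lemma avg_le X (f g : X -> R) : (forall x, f x <= g x) -> avg f <= avg g.
Proof.
by move=> fg; apply: ler_wpM2r; rewrite ?invr_ge0 ?ler0n //; apply: ler_sum.
Qed.

Lemma avg_ge0 X (f : X -> R) : (forall x, 0 <= f x) -> 0 <= avg f.
Proof.
by move=> f0; apply: mulr_ge0; [apply: sumr_ge0|rewrite invr_ge0 ler0n].
Qed.

Lemma avgD X (f g : X -> R) : avg (fun x => f x + g x) = avg f + avg g.
Proof. by rewrite /avg big_split /= mulrDl. Qed.

Lemma avgZ X (c : R) (f : X -> R) : avg (fun x => c * f x) = c * avg f.
Proof. by rewrite /avg -mulr_sumr mulrA. Qed.

Lemma avg_sum X (I : finType) (P : pred I) (F : I -> X -> R) :
  avg (fun x => \sum_(i | P i) F i x) = \sum_(i | P i) avg (F i).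
Proof. by rewrite /avg exchange_big /= mulr_suml. Qed.

Lemma avg_cst X (c : R) : (0 < #|X|)%N -> avg (fun _ : X => c) = c.
Proof.
move=> X0; rewrite /avg sumr_const -[c *+ _]mulr_natr mulfK //.
by rewrite pnatr_eq0 -lt0n.
Qed.

Lemma avg_pair X Y (f : X * Y -> R) :
  avg f = avg (fun x => avg (fun y => f (x, y))).
Proof.
rewrite /avg card_prod natrM invfM mulrA; rewrite mulrAC -mulr_suml.
by rewrite pair_bigA /=; congr (_ * _ * _); apply: eq_bigr => -[].
Qed.

Lemma avg_pairC X Y (f : X -> Y -> R) :
  avg (fun x => avg (fun y => f x y)) = avg (fun y => avg (fun x => f x y)).
Proof.
by rewrite /avg -!mulr_suml exchange_big /= mulrAC.
Qed.

Lemma avg_bij X Y (h : X -> Y) (f : Y -> R) :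
  bijective h -> avg (fun x => f (h x)) = avg f.
Proof.
move=> bh; rewrite /avg (bij_eq_card bh); congr (_ / _).
by rewrite [RHS](reindex h) //; apply: onW_bij.
Qed.

Lemma avg_ffun_prod X (I : finType) (phi : I -> X -> R) :
  avg (fun f : {ffun I -> X} => \prod_i phi i (f i)) = \prod_i avg (phi i).
Proof.
rewrite /avg big_split /= bigA_distr_bigA /=; congr (_ * _).
by rewrite prodr_const card_ffun natrX exprVn.
Qed.

Lemma exists_le_avg X (f : X -> R) : (0 < #|X|)%N -> exists x, f x <= avg f.
Proof.
move=> X0; apply/not_existsP => nf.
have lf x : avg f < f x by rewrite ltNge; apply/negP/nf.
have /card_gt0P[x0 _] := X0.
have : (\sum_(x : X) avg f) / #|X|%:R < avg f.
  rewrite [ltRHS]/avg ltr_pM2r ?invr_gt0 ?ltr0n //.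
  by apply: ltr_sum => //; apply/hasP; exists x0 => //; rewrite mem_index_enum.
by rewrite -[ltLHS]/(avg (fun _ : X => avg f)) avg_cst // ltxx.
Qed.

Lemma avg_bool (f : bool -> R) : avg f = (f true + f false) / 2.
Proof. by rewrite /avg big_bool card_bool. Qed.

Lemma fcons_bij X N : bijective (fun p : X * {ffun 'I_N -> X} => fcons p.1 p.2).
Proof.
exists (fun f : {ffun 'I_N.+1 -> X} =>
  (f ord0, [ffun i : 'I_N => f (lift ord0 i)])).
  move=> [x g] /=; rewrite /fcons ffunE unlift_none /=; congr (_, _).
  by apply/ffunP => i; rewrite !ffunE liftK.
move=> f; apply/ffunP => i; rewrite ffunE /=.
by case: unliftP => [j|] -> //=; rewrite ffunE.
Qed.

Lemma sum_fcons X N (F : {ffun 'I_N.+1 -> X} -> R) :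
  \sum_f F f = \sum_x \sum_(g : {ffun 'I_N -> X}) F (fcons x g).
Proof.
rewrite (reindex (fun p : X * {ffun 'I_N -> X} => fcons p.1 p.2)) /=.
  by rewrite pair_bigA.
by apply: onW_bij; apply: fcons_bij.
Qed.

Lemma avg_fcons X N (F : {ffun 'I_N.+1 -> X} -> R) :
  avg F = avg (fun x => avg (fun g : {ffun 'I_N -> X} => F (fcons x g))).
Proof.
by rewrite -(avg_bij _ (@fcons_bij X N)) avg_pair.
Qed.

Lemma big_ord_fcons X N (x : X) (g : {ffun 'I_N -> X}) (V : 'I_N.+1 -> X -> R) :
  \sum_i V i (fcons x g i) = V ord0 x + \sum_i V (lift ord0 i) (g i).
Proof.
rewrite big_ord_recl ffunE unlift_none /=; congr (_ + _).
by apply: eq_bigr => i _; rewrite ffunE liftK.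
Qed.

End Averages.

(** * Counting integer points *)

Section IntegerPoints.
Context {R : realType}.

Lemma sum_exp_dist (g y : R) (B : nat) : 0 < g ->
  \sum_(k < B) expR (- (g * `|k%:R - y|)) <= 2 / (1 - expR (- g)).
Proof.
move=> g0; set r := expR (- g).
(* Up to the factor 1 - r, the summand is at most the increment of a
   nondecreasing function with values between 0 and 2. *)
have r0 : 0 < r by apply: expR_gt0.
have r1 : r < 1 by rewrite expR_lt1 oppr_lt0.
pose Phi t := if t <= y then expR (- (g * (y - t)))
              else 2 - expR (- (g * (t - y))).
have Phi0 t : 0 <= Phi t.
  rewrite /Phi; case: ifPn => [_|]; first exact: expR_ge0.
  rewrite -ltNge => yt; rewrite subr_ge0.
  apply: (@le_trans _ _ 1); last by rewrite ler1n.
  by rewrite expR_le1 oppr_le0 mulr_ge0 ?subr_ge0 // ltW.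
have Phi2 t : Phi t <= 2.
  rewrite /Phi; case: ifPn => [ty|_].
    apply: (@le_trans _ _ 1); last by rewrite ler1n.
    by rewrite expR_le1 oppr_le0 mulr_ge0 ?subr_ge0 // ltW.
  by rewrite lerBlDr lerDl expR_ge0.
have step t : (1 - r) * expR (- (g * `|t - y|)) <= Phi (t + 1) - Phi t.
  have [yt|ty] := leP y t.
    have -> : Phi (t + 1) = 2 - r * expR (- (g * (t - y))).
      rewrite /Phi leNgt (le_lt_trans yt) ?ltrDl //=.
      by rewrite -expRD; congr (_ - expR _); ring.
    have -> : Phi t = 2 - expR (- (g * (t - y))).
      rewrite /Phi; case: ifPn => // ty.
      have -> : t = y by apply/eqP; rewrite eq_le ty yt.
      by rewrite !subrr mulr0 oppr0 expR0; ring.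
    rewrite ger0_norm ?subr_ge0 //.
    rewrite le_eqVlt; apply/orP; left; apply/eqP; ring.
  rewrite ltr0_norm ?subr_lt0 // opprB.
  have -> : Phi t = expR (- (g * (y - t))) by rewrite /Phi ltW.
  rewrite /Phi; case: ifPn => [ty1|].
    have -> : expR (- (g * (y - t))) = r * expR (- (g * (y - (t + 1)))).
      by rewrite -expRD; congr expR; ring.
    have := expR_gt0 (- (g * (y - (t + 1)))); set w := expR _ => w0.
    have : 0 <= w * ((1 - r) * (1 - r)).
      by rewrite !mulr_ge0 ?(ltW w0) ?subr_ge0 ?(ltW r1).
    by lra.
  rewrite -ltNge => yt1.
  have pq : expR (- (g * (y - t))) * expR (- (g * (t + 1 - y))) = r.
    by rewrite -expRD; congr expR; ring.
  have p0 := expR_gt0 (- (g * (y - t))).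
  have q0 := expR_gt0 (- (g * (t + 1 - y))).
  have p1 : expR (- (g * (y - t))) <= 1.
    by rewrite expR_le1 oppr_le0 mulr_ge0 ?subr_ge0 // ltW.
  have q1 : expR (- (g * (t + 1 - y))) <= 1.
    by rewrite expR_le1 oppr_le0 mulr_ge0 ?subr_ge0 // ltW.
  move: pq p0 q0 p1 q1; set p := expR _; set q := expR _ => <- *.
  have : 0 <= (1 - p) * (1 - q) by rewrite mulr_ge0 ?subr_ge0.
  have : 0 <= (1 - p * q) * (1 - p).
    by rewrite mulr_ge0 ?subr_ge0 // mulr_ile1 // ltW.
  by lra.
rewrite ler_pdivlMr ?subr_gt0 // mulrC mulr_sumr.
apply: (@le_trans _ _ (\sum_(0 <= k < B) (Phi k.+1%:R - Phi k%:R))).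
  by rewrite big_mkord; apply: ler_sum => k _; rewrite -natr1; apply: step.
rewrite (@telescope_sumr _ 0 B (fun k => Phi k%:R)) //.
by rewrite lerBlDr (le_trans (Phi2 _)) // lerDl.
Qed.

Lemma expRN1_le : expR (-1) <= 1 / 2 :> R.
Proof.
rewrite expRN div1r lef_pV2 ?posrE ?expR_gt0 ?ltr0n //.
by have := @expR_ge1Dx R 1; lra.
Qed.

Lemma expR_mid (u v : R) : expR ((u + v) / 2) <= (expR u + expR v) / 2.
Proof.
have -> : expR u = expR (u / 2) ^+ 2 by rewrite -expRM_natl; congr expR; lra.
have -> : expR v = expR (v / 2) ^+ 2 by rewrite -expRM_natl; congr expR; lra.
rewrite mulrDl expRD.
have := sqr_ge0 (expR (u / 2) - expR (v / 2)).
by rewrite !expr2; nra.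
Qed.

(** The largest value of [<s, z> - M s] over the signs [s], where [z] is the
    integer vector whose coordinates are encoded in ['I_B] with offset [b]. *)
Definition signsup (N B : nat) (b : R) (M : {ffun 'I_N -> bool} -> R)
    (z : {ffun 'I_N -> 'I_B}) : R :=
  let F (s : {ffun 'I_N -> bool}) := \sum_i sg R (s i) * ((z i)%:R - b) - M s in
  \big[Num.max/F [ffun=> false]]_s F s.

Lemma signsup_ge N B b M (z : {ffun 'I_N -> 'I_B})
  (s : {ffun 'I_N -> bool}) :
  \sum_i sg R (s i) * ((z i)%:R - b) - M s <= signsup b M z.
Proof.
exact: (le_bigmax _ (fun s : {ffun 'I_N -> bool} =>
  \sum_i sg R (s i) * ((z i)%:R - b) - M s)).
Qed.

Lemma signsup_le N B b M (z : {ffun 'I_N -> 'I_B}) c :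
  (forall s : {ffun 'I_N -> bool}, \sum_i sg R (s i) * ((z i)%:R - b) - M s <= c) ->
  signsup b M z <= c.
Proof. by move=> h; apply: bigmax_le. Qed.

(** By induction on the dimension: the sum over one coordinate [k] of
    [exp (- max (x + k) (y - k))] is at most [4 exp (- (x + y) / 2)], and the
    convexity of the exponential separates the two halves of the cube. *)
Lemma sum_exp_signsup N B b (M : {ffun 'I_N -> bool} -> R) :
  \sum_(z : {ffun 'I_N -> 'I_B}) expR (- signsup b M z) <=
    4 ^+ N * expR (avg M).
Proof.
elim: N M => [|N IH] M.
  have c0 (X : finType) : #|{ffun 'I_0 -> X}| = 1%N.
    by rewrite card_ffun card_ord expn0.
  have /card_le1P : (#|{: {ffun 'I_0 -> bool}}| <= 1)%N by rewrite c0.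
  have e0 (X : finType) (f g : {ffun 'I_0 -> X}) : f = g.
    by apply/ffunP => -[].
  rewrite expr0 mul1r => _.
  have -> : avg M = M [ffun=> false].
    rewrite -[RHS](@avg_cst R {ffun 'I_0 -> bool}) ?c0 //.
    by apply: avg_eq => s; congr M; apply: e0.
  apply: (@le_trans _ _ (\sum_(z : {ffun 'I_0 -> 'I_B}) expR (M [ffun=> false]))).
    apply: ler_sum => z _; rewrite ler_expR lerNl.
    apply: le_trans (signsup_ge _ _ _ [ffun=> false]).
    by rewrite big_ord0 sub0r.
  by rewrite sumr_const c0 mulr1n.
pose Mp (s : {ffun 'I_N -> bool}) := M (fcons true s); pose Mm (s : {ffun 'I_N -> bool}) := M (fcons false s).
rewrite sum_fcons exchange_big /=.
have avgM : avg M = (avg Mp + avg Mm) / 2.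
  by rewrite avg_fcons avg_bool.
have hp (x : 'I_B) (g : {ffun 'I_N -> 'I_B}) :
    signsup b Mm g + (x%:R - b) <= signsup b M (fcons x g).
  rewrite -lerBrDr; apply: signsup_le => s; rewrite lerBrDr.
  apply: le_trans (signsup_ge _ _ _ (fcons false s)).
  rewrite big_ord_recl !ffunE !unlift_none /= /sg expr0 mul1r.
  rewrite [X in _ <= _ + X - _](eq_bigr (fun i => (-1) ^+ s i * ((g i)%:R - b))).
    by rewrite /Mm; lra.
  by move=> i _; rewrite !ffunE !liftK.
have hm (x : 'I_B) (g : {ffun 'I_N -> 'I_B}) :
    signsup b Mp g - (x%:R - b) <= signsup b M (fcons x g).
  rewrite lerBlDr; apply: signsup_le => s; rewrite -lerBlDr.
  apply: le_trans (signsup_ge _ _ _ (fcons true s)).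
  rewrite big_ord_recl !ffunE !unlift_none /= /sg expr1.
  rewrite [X in _ <= _ + X - _](eq_bigr (fun i => (-1) ^+ s i * ((g i)%:R - b))).
    by rewrite /Mp; lra.
  by move=> i _; rewrite !ffunE !liftK.
have fibre (g : {ffun 'I_N -> 'I_B}) :
  \sum_(x < B) expR (- signsup b M (fcons x g)) <=
  4 * expR (- ((signsup b Mp g + signsup b Mm g) / 2)).
  set u := signsup b Mp g; set v := signsup b Mm g.
  pose y := (u - v) / 2 + b.
  apply: (@le_trans _ _ (\sum_(x < B)
      expR (- ((u + v) / 2)) * expR (- (1 * `|x%:R - y|)))).
    apply: ler_sum => x _; rewrite -expRD ler_expR.
    have := hp x g; have := hm x g; rewrite -/u -/v.
    by rewrite /y; case: (ler0P (x%:R - ((u - v) / 2 + b))); lra.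
  rewrite -mulr_sumr mulrC ler_wpM2r ?expR_ge0 //.
  apply: le_trans (sum_exp_dist _ _ _) _ => //.
  rewrite ler_pdivrMr; first by have := expRN1_le; lra.
  by have := expRN1_le; lra.
apply: le_trans (ler_sum _ (fun g _ => fibre g)) _.
rewrite -mulr_sumr exprS -mulrA ler_pM2l ?ltr0n // avgM.
apply: (@le_trans _ _ (\sum_(g : {ffun 'I_N -> 'I_B})
   (expR ((avg Mp + avg Mm) / 2) / 2) *
     (expR (- avg Mp) * expR (- signsup b Mp g)
      + expR (- avg Mm) * expR (- signsup b Mm g)))).
  apply: ler_sum => g _; rewrite -!expRD mulrAC -mulrA.
  have := expR_mid (- avg Mp - signsup b Mp g) (- avg Mm - signsup b Mm g).
  move/(ler_wpM2l (expR_ge0 ((avg Mp + avg Mm) / 2))); apply: le_trans.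
  by rewrite -expRD ler_expR; lra.
rewrite -mulr_sumr big_split /= -!mulr_sumr mulrC.
have hP := ler_wpM2l (expR_ge0 (- avg Mp)) (IH Mp).
have hM := ler_wpM2l (expR_ge0 (- avg Mm)) (IH Mm).
have eP : expR (- avg Mp) * (4 ^+ N * expR (avg Mp)) = 4 ^+ N.
  by rewrite mulrCA -expRD addNr expR0 mulr1.
have eM : expR (- avg Mm) * (4 ^+ N * expR (avg Mm)) = 4 ^+ N.
  by rewrite mulrCA -expRD addNr expR0 mulr1.
rewrite eP in hP; rewrite eM in hM.
apply: le_trans (ler_wpM2r _ (lerD hP hM)) _; last by lra.
by rewrite divr_ge0 ?expR_ge0.
Qed.

End IntegerPoints.

Section Reindexing.
Context {R : realType}.

Lemma ffun_comp_bij (A B X : finType) (e : A -> B) : bijective e ->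
  bijective (fun g : {ffun B -> X} => [ffun a => g (e a)]).
Proof.
move=> [e' ee' e'e]; exists (fun g : {ffun A -> X} => [ffun b => g (e' b)]) => g;
  by apply/ffunP => a; rewrite !ffunE ?ee' ?e'e.
Qed.

(** The set defined by [<s, z> <= M s] for all sign vectors [s] has at most
    $4^{|T|} \exp(\mathrm{avg}\, M)$ integer points. *)
Lemma card_integer_points (T : finType) (B : nat) (b : R)
    (M : {ffun T -> bool} -> R) (P : pred {ffun T -> 'I_B}) :
  (forall z, P z -> forall s : {ffun T -> bool},
      \sum_t sg R (s t) * ((z t)%:R - b) <= M s) ->
  #|P|%:R <= 4 ^+ #|T| * expR (avg M).
Proof.
move=> hP.
have bv : bijective (@enum_val T predT) by apply: enum_val_bij.
have br : bijective (@enum_rank T) by apply: enum_rank_bij.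
pose M' (s : {ffun 'I_#|T| -> bool}) := M [ffun t => s (enum_rank t)].
have -> : avg M = avg M'.
  by rewrite -(avg_bij M (ffun_comp_bij bool br)).
apply: le_trans _ (@sum_exp_signsup R _ B b M').
rewrite (reindex (fun z : {ffun T -> 'I_B} => [ffun i => z (enum_val i)])) /=; last first.
  by apply: onW_bij; apply: ffun_comp_bij.
rewrite (bigID P) /= -[leLHS]addr0 lerD //; last first.
  by apply: sumr_ge0 => z _; apply: expR_ge0.
rewrite -(sum1_card P) natr_sum; apply: ler_sum => z Pz.
rewrite -[leLHS]expR0 ler_expR oppr_ge0; apply: signsup_le => s.
rewrite subr_le0 /M'; apply: le_trans (hP _ Pz _).
rewrite [leRHS](reindex (@enum_val T predT)) /=; last exact: onW_bij.
apply: ler_sum => i _.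
by rewrite !ffunE; have -> : enum_rank (enum_val i) = i by apply: enum_valK.
Qed.

End Reindexing.

(** * Random signs *)

Section RandomSigns.
Context {R : realType}.

Lemma sgM (b : bool) (x : R) : sg R b * x = if b then - x else x.
Proof. by rewrite /sg; case: b; rewrite ?expr1 ?expr0 ?mulN1r ?mul1r. Qed.

Lemma cosh_le (x : R) : (expR x + expR (- x)) / 2 <= expR (2 * x ^+ 2).
Proof.
have [x1|x1] := leP (x ^+ 2) (1 / 2).
  have h1 : expR x <= (1 - x)^-1.
    rewrite -[x in expR x]opprK expRN lef_pV2 ?posrE ?expR_gt0 //; last by nra.
    exact: expR_ge1Dx.
  have h2 : expR (- x) <= (1 + x)^-1.
    rewrite expRN lef_pV2 ?posrE ?expR_gt0 //; last by nra.
    exact: expR_ge1Dx.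
  have h3 := @expR_ge1Dx R (2 * x ^+ 2).
  apply: le_trans h3.
  have xp : 0 < 1 + x by nra.
  have xm : 0 < 1 - x by nra.
  apply: (@le_trans _ _ (((1 - x)^-1 + (1 + x)^-1) / 2)); first by lra.
  have -> : ((1 - x)^-1 + (1 + x)^-1) / 2 = ((1 - x) * (1 + x))^-1.
    by field; rewrite !gt_eqF.
  rewrite -[leLHS]mul1r ler_pdivrMr ?mulr_gt0 //.
  by have := sqr_ge0 x; nra.
have h : `|x| <= 2 * x ^+ 2.
  rewrite -[in leRHS]real_normK ?num_real //.
  move: x1; rewrite -[x ^+ 2]real_normK ?num_real // => x1.
  by have := normr_ge0 x; nra.
have h1 : expR x <= expR (2 * x ^+ 2).
  by rewrite ler_expR (le_trans (ler_norm _)).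
have h2 : expR (- x) <= expR (2 * x ^+ 2).
  by rewrite ler_expR (le_trans (ler_norm _)) // normrN.
by lra.
Qed.

Lemma avg_exp_sign_le (T : finType) (v : T -> R) :
  avg (fun s : {ffun T -> bool} => expR (\sum_t sg R (s t) * v t)) <=
  expR (2 * \sum_t v t ^+ 2).
Proof.
rewrite (avg_eq (g := fun s : {ffun T -> bool} =>
    \prod_t expR (sg R (s t) * v t))); last by move=> s; rewrite expR_sum.
rewrite (avg_ffun_prod (fun t (b : bool) => expR (sg R b * v t))).
rewrite mulr_sumr expR_sum; apply: ler_prod => t _.
rewrite avg_bool !sgM addrC cosh_le andbT.
by rewrite divr_ge0 // addr_ge0 ?expR_ge0.
Qed.

Lemma avg_sign_sqr N (a : 'I_N -> R) :
  avg (fun s : {ffun 'I_N -> bool} => (\sum_i sg R (s i) * a i) ^+ 2) =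
  \sum_i a i ^+ 2.
Proof.
elim: N a => [|N IH] a.
  rewrite big_ord0 (avg_eq (g := fun=> 0)) ?avg_cst ?card_ffun ?card_ord ?expn0 //.
  by move=> s; rewrite big_ord0 expr0n.
rewrite avg_fcons (avg_pairC (fun x (g : {ffun 'I_N -> bool}) => _)).
rewrite big_ord_recl -IH.
rewrite -[X in X + _](@avg_cst _ {ffun 'I_N -> bool}) ?card_ffun ?expn_gt0 ?card_bool //.
rewrite -avgD; apply: avg_eq => s; rewrite avg_bool.
rewrite !(big_ord_fcons _ _ (fun i b => sg R b * a i)) !sgM.
by set X := \sum_(i < N) _; field.
Qed.

Lemma avg_sign_fourth N (a : 'I_N -> R) :
  avg (fun s : {ffun 'I_N -> bool} => (\sum_i sg R (s i) * a i) ^+ 4) <=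
  3 * (\sum_i a i ^+ 2) ^+ 2.
Proof.
elim: N a => [|N IH] a.
  rewrite big_ord0 (avg_eq (g := fun=> 0)) ?avg_cst ?card_ffun ?card_ord ?expn0 //.
  by move=> s; rewrite big_ord0 expr0n.
rewrite avg_fcons (avg_pairC (fun x (g : {ffun 'I_N -> bool}) => _)).
rewrite big_ord_recl.
pose X (s : {ffun 'I_N -> bool}) := \sum_(i < N) sg R (s i) * a (lift ord0 i).
have c0 : (0 < #|{: {ffun 'I_N -> bool}}|)%N by rewrite card_ffun expn_gt0 card_bool.
rewrite (avg_eq (g := fun s => X s ^+ 4 + ((6 * a ord0 ^+ 2) * X s ^+ 2 + a ord0 ^+ 4))).
  rewrite avgD avgD avgZ avg_cst // avg_sign_sqr.
  have := IH (fun i => a (lift ord0 i)).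
  set v := \sum_(i < N) _; set w := avg _ => h.
  have : 0 <= (a ord0 ^+ 2) ^+ 2 by apply: sqr_ge0.
  by nra.
move=> s; rewrite avg_bool.
rewrite !(big_ord_fcons _ _ (fun i b => sg R b * a i)) !sgM -/(X s).
by field.
Qed.

(** Paley-Zygmund: a random signed sum of the coordinates of a vector of
    Euclidean norm [A] is at least [A / 2] in absolute value with probability at
    least [1 / 5]. *)
Lemma sign_small_ball N (a : 'I_N -> R) (A : R) : 0 < A ->
  \sum_i a i ^+ 2 = A ^+ 2 ->
  avg (fun s : {ffun 'I_N -> bool} =>
    (`|\sum_i sg R (s i) * a i| < A / 2)%R%:R) <= 4 / 5 :> R.
Proof.
move=> A0 hA.
pose X (s : {ffun 'I_N -> bool}) := \sum_i sg R (s i) * a i.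
have c0 : (0 < #|{: {ffun 'I_N -> bool}}|)%N by rewrite card_ffun expn_gt0 card_bool.
(* The polynomial (x^2 - 1/4 - x^4/8) * 4/7 is at most the indicator of
   |x| >= 1/2. *)
apply: (@le_trans _ _ (avg (fun s => 1 + (1/7 + ((- (4/7) / A ^+ 2) * X s ^+ 2
   + (1/14 / A ^+ 4) * X s ^+ 4))))).
  apply: avg_le => s; rewrite -/(X s).
  pose u := (X s / A) ^+ 2.
  have -> : - (4/7) / A ^+ 2 * X s ^+ 2 = - (4/7) * u.
    by rewrite /u; field; rewrite gt_eqF.
  have -> : 1/14 / A ^+ 4 * X s ^+ 4 = 1/14 * u ^+ 2.
    by rewrite /u; field; rewrite gt_eqF.
  have u0 : 0 <= u by apply: sqr_ge0.
  case: ltP => [h|h]; last by rewrite mulr0n; have := sqr_ge0 (u - 4); nra.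
  suff : u <= 1/4 by rewrite mulr1n; nra.
  have -> : 1/4 = (1/2) ^+ 2 :> R by field.
  rewrite /u -[leLHS]real_normK ?num_real // ler_sqr ?nnegrE ?normr_ge0 ?divr_ge0 //.
  by rewrite normrM normfV (gtr0_norm A0) ler_pdivrMr //; lra.
rewrite !avgD !avgZ !avg_cst // avg_sign_sqr hA.
have := avg_sign_fourth a; rewrite hA => h4.
have -> : - (4/7) / A ^+ 2 * A ^+ 2 = - (4/7) by field; rewrite gt_eqF.
suff : 1/14 / A ^+ 4 * avg (fun s => X s ^+ 4) <= 3/14 by rewrite /X; lra.
have -> : 3/14 = 1/14 / A ^+ 4 * (3 * (A ^+ 2) ^+ 2) by field; rewrite gt_eqF.
by rewrite ler_wpM2l // divr_ge0 ?exprn_ge0 ?(ltW A0).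
Qed.

End RandomSigns.

(** * Euclidean norm and nets *)

(** The Euclidean norm of a family of reals indexed by a finite type. *)
Definition nrm (R : realType) (T : finType) (u : T -> R) : R :=
  Num.sqrt (\sum_t u t ^+ 2).

(** The trilinear form whose coefficients are the entries of [S]. *)
Definition tri (R : realType) (n : nat) (S : 'I_n * 'I_n * 'I_n -> R)
    (x y z : 'I_n -> R) : R :=
  \sum_t S t * (x t.1.1 * y t.1.2 * z t.2).

Section EuclideanNorm.
Context {R : realType}.
Implicit Types T : finType.

Lemma nrm_ge0 T (u : T -> R) : 0 <= nrm u.
Proof. exact: sqrtr_ge0. Qed.

Lemma nrm_sqr T (u : T -> R) : nrm u ^+ 2 = \sum_t u t ^+ 2.
Proof. by rewrite sqr_sqrtr // sumr_ge0 // => t _; apply: sqr_ge0. Qed.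

Lemma nrm_eq T (u v : T -> R) : u =1 v -> nrm u = nrm v.
Proof. by move=> uv; congr Num.sqrt; apply: eq_bigr => t _; rewrite uv. Qed.

Lemma nrm_le T (u : T -> R) c : 0 <= c -> \sum_t u t ^+ 2 <= c ^+ 2 -> nrm u <= c.
Proof.
by move=> c0; rewrite -nrm_sqr ler_sqr // nnegrE nrm_ge0.
Qed.

Lemma nrm_coord T (u : T -> R) t : `|u t| <= nrm u.
Proof.
rewrite -ler_sqr ?nnegrE ?nrm_ge0 // nrm_sqr real_normK ?num_real //.
by rewrite (bigD1 t) //= lerDl sumr_ge0 // => i _; apply: sqr_ge0.
Qed.

Lemma nrm0_eq0 T (u : T -> R) : nrm u = 0 -> forall t, u t = 0.
Proof.
by move=> u0 t; apply/eqP; rewrite -normr_eq0 eq_le normr_ge0 andbT -u0 nrm_coord.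
Qed.

Lemma nrmZ T c (u : T -> R) : nrm (fun t => c * u t) = `|c| * nrm u.
Proof.
apply/eqP; rewrite -(eqrXn2 (n := 2)) ?mulr_ge0 ?nrm_ge0 //.
rewrite exprMn !nrm_sqr real_normK ?num_real // mulr_sumr.
by apply/eqP; apply: eq_bigr => t _; rewrite exprMn.
Qed.

Lemma nrmN T (u : T -> R) : nrm (fun t => - u t) = nrm u.
Proof. by congr Num.sqrt; apply: eq_bigr => t _; rewrite sqrrN. Qed.

Lemma cauchy_schwarz T (u v : T -> R) : \sum_t u t * v t <= nrm u * nrm v.
Proof.
have [u0|u0] := eqVneq (nrm u) 0.
  by rewrite u0 mul0r big1 // => t _; rewrite (nrm0_eq0 u0) mul0r.
have [v0|v0] := eqVneq (nrm v) 0.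
  by rewrite v0 mulr0 big1 // => t _; rewrite (nrm0_eq0 v0) mulr0.
have up : 0 < nrm u by rewrite lt_def u0 nrm_ge0.
have vp : 0 < nrm v by rewrite lt_def v0 nrm_ge0.
pose l := nrm v / nrm u.
have l0 : 0 < l by apply: divr_gt0.
apply: (@le_trans _ _ (\sum_t ((l / 2) * u t ^+ 2 + (l^-1 / 2) * v t ^+ 2))).
  apply: ler_sum => t _.
  have -> : l / 2 * u t ^+ 2 + l^-1 / 2 * v t ^+ 2 =
     u t * v t + (l * u t - v t) ^+ 2 / (2 * l) by field; rewrite gt_eqF.
  by rewrite lerDl divr_ge0 ?sqr_ge0 // mulr_ge0 // ltW.
rewrite big_split /= -!mulr_sumr -!nrm_sqr /l le_eqVlt; apply/orP; left.
by apply/eqP; field; rewrite !gt_eqF.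
Qed.

Lemma nrmD T (u v : T -> R) : nrm (fun t => u t + v t) <= nrm u + nrm v.
Proof.
apply: nrm_le; first by rewrite addr_ge0 ?nrm_ge0.
rewrite (eq_bigr (fun t => u t ^+ 2 + (2 * (u t * v t) + v t ^+ 2))); last first.
  by move=> t _; ring.
rewrite !big_split /= -mulr_sumr -!nrm_sqr.
by have := cauchy_schwarz u v; nra.
Qed.

Lemma nrm_bounded T (u : T -> R) (N : nat) : #|T| = N ->
  (forall t, `|u t| <= 1) -> nrm u <= Num.sqrt N%:R.
Proof.
move=> cT hu; apply: nrm_le; rewrite ?sqrtr_ge0 // sqr_sqrtr ?ler0n //.
rewrite -cT -sum1_card natr_sum; apply: ler_sum => t _.
by rewrite -[leLHS]real_normK ?num_real // expr_le1.
Qed.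

(** Rounding a real number to an integer encoded with offset [b]. *)
Lemma round_box (b : nat) (x : R) : `|x| <= b%:R ->
  exists k : 'I_(2 * b).+1, `|x - (k%:R - b%:R)| <= 1.
Proof.
rewrite ler_norml => /andP[xb bx].
have xb0 : 0 <= x + b%:R by lra.
have /andP[h1 h2] := truncn_itv xb0.
have h : (Num.truncn (x + b%:R) < (2 * b).+1)%N.
  rewrite -(ltr_nat R); apply: le_lt_trans h1 _.
  by rewrite -natr1 natrM; lra.
exists (Ordinal h) => /=; move: h2; rewrite -natr1 ler_norml => h2.
by apply/andP; split; lra.
Qed.

End EuclideanNorm.

Section Nets.
Context {R : realType}.

(** Vectors with integer coordinates divided by [2 * sqrt n], the integers being
    encoded with offset [9 * n]. *)
Definition netv (n : nat) (z : {ffun 'I_n -> 'I_(2 * (9 * n)).+1}) (i : 'I_n) : R :=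
  ((z i)%:R - (9 * n)%:R) / (2 * Num.sqrt n%:R).

(** Those of Euclidean norm at most [3 / 2]. A linear form bounded by [B] on
    them has norm at most [2 * B]. *)
Definition net (n : nat) : pred {ffun 'I_n -> 'I_(2 * (9 * n)).+1} :=
  fun z => \sum_i ((z i)%:R - (9 * n)%:R) ^+ 2 <= (9 * n)%:R :> R.

Lemma natr_dist_le_sqr (k b : nat) : `|k%:R - b%:R| <= (k%:R - b%:R) ^+ 2 :> R.
Proof.
have sq (m : nat) : m%:R <= (m%:R : R) ^+ 2.
  by rewrite -natrX ler_nat; case: m => // m; rewrite expnS leq_pmulr.
have [kb|/ltnW kb] := leqP b k; first by rewrite -natrB // ger0_norm.
by rewrite distrC -sqrrN opprB -natrB // ger0_norm.
Qed.

Lemma card_net n : #|@net n|%:R <= expR (11 * n%:R) :> R.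
Proof.
have := @card_integer_points R 'I_n (2 * (9 * n)).+1 (9 * n)%:R
  (fun=> (9 * n)%:R) (@net n).
rewrite avg_cst ?card_ffun ?expn_gt0 ?card_bool // card_ord => h.
apply: (@le_trans _ _ (4 ^+ n * expR (9 * n)%:R)).
  apply: h => z hz s; apply: le_trans hz.
  apply: ler_sum => i _; apply: le_trans (natr_dist_le_sqr _ _).
  rewrite sgM; case: (s i); last exact: ler_norm.
  by rewrite -normrN; apply: ler_norm.
have e4 : 4 <= expR 2 :> R.
  have -> : 2 = 1 + 1 :> R by [].
  by rewrite expRD; have := @expR_ge1Dx R 1; nra.
have -> : 11 * n%:R = 2 * n%:R + (9 * n)%:R :> R by rewrite natrM; ring.
rewrite expRD ler_pM2r ?expR_gt0 // expRM_natr.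
by apply: lerXn2r; rewrite ?nnegrE ?expR_ge0.
Qed.

Lemma net_norm n (z : {ffun 'I_n -> 'I_(2 * (9 * n)).+1}) : net z ->
  nrm (netv z) <= 3 / 2.
Proof.
move=> hz; apply: nrm_le; first by rewrite divr_ge0.
case: n z hz => [|n] z hz; first by rewrite big_ord0 sqr_ge0.
rewrite (eq_bigr (fun i => (4 * n.+1%:R)^-1 * ((z i)%:R - (9 * n.+1)%:R) ^+ 2)).
  rewrite -mulr_sumr mulrC ler_pdivrMr ?mulr_gt0 ?ltr0n //.
  by apply: le_trans hz _; rewrite natrM; lra.
move=> i _; rewrite /netv !exprMn exprVn exprMn sqr_sqrtr ?ler0n //.
by rewrite mulrC -natrX.
Qed.

Lemma net_sup n (g : 'I_n -> R) (B : R) :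
  (forall z, net z -> \sum_i g i * netv z i <= B) -> nrm g <= 2 * B.
Proof.
move=> hB.
have B0 : 0 <= B.
  have h9 : (9 * n < (2 * (9 * n)).+1)%N by rewrite ltnS leq_pmull.
  have : @net n [ffun=> Ordinal h9].
    by rewrite /net big1 ?ler0n // => i _; rewrite ffunE subrr expr0n.
  move/hB; rewrite big1 // => i _.
  by rewrite /netv ffunE subrr mul0r mulr0.
have [g0|gn0] := eqVneq (nrm g) 0; first by rewrite g0 mulr_ge0.
have gp : 0 < nrm g by rewrite lt_def gn0 nrm_ge0.
case: n => [|n] in g hB B0 gn0 gp *.
  by move: gn0; rewrite /nrm big_ord0 sqrtr0 eqxx.
set q := Num.sqrt n.+1%:R : R.
have q0 : 0 < q by rewrite sqrtr_gt0 ltr0n.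
have qq : q ^+ 2 = n.+1%:R by rewrite sqr_sqrtr ?ler0n.
have qn : q <= n.+1%:R.
  rewrite -qq expr2 ler_peMr ?(ltW q0) //.
  by rewrite -ler_sqr ?nnegrE ?(ltW q0) // qq expr1n ler1n.
pose x i := 2 * q / nrm g * g i.
have xnrm : nrm x = 2 * q.
  rewrite nrmZ ger0_norm ?divr_ge0 ?mulr_ge0 ?(ltW q0) ?(ltW gp) //.
  by rewrite divfK.
have xb i : `|x i| <= (9 * n.+1)%:R.
  apply: le_trans (nrm_coord _ _) _; rewrite xnrm natrM.
  by move: qn q0; lra.
pose z := [ffun i => xchoose (round_box (xb i))].
have zP i : `|x i - ((z i)%:R - (9 * n.+1)%:R)| <= 1.
  by rewrite ffunE; apply: (xchooseP (round_box (xb i))).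
pose d i := x i - ((z i)%:R - (9 * n.+1)%:R).
have dn : nrm d <= q by apply: nrm_bounded; rewrite ?card_ord.
have zn : net z.
  rewrite /net -nrm_sqr.
  have e9 : (9 * n.+1)%:R = (3 * q) ^+ 2 :> R by rewrite exprMn qq natrM; ring.
  rewrite [leRHS]e9.
  rewrite ler_sqr ?nnegrE ?nrm_ge0 ?mulr_ge0 ?(ltW q0) //.
  rewrite (nrm_eq (v := fun i => x i + - d i)); last by move=> i; rewrite /d opprB [RHS]addrC subrK.
  by apply: le_trans (nrmD _ _) _; rewrite nrmN xnrm; lra.
have := hB z zn.
rewrite (eq_bigr (fun i => (nrm g)^-1 * g i ^+ 2 + - (2 * q)^-1 * (g i * d i))).
  rewrite big_split /= -!mulr_sumr -nrm_sqr => h.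
  have h2 : (2 * q)^-1 * \sum_i g i * d i <= nrm g / 2.
    rewrite mulrC ler_pdivrMr ?mulr_gt0 //.
    apply: le_trans (cauchy_schwarz _ _) _.
    have -> : nrm g / 2 * (2 * q) = nrm g * q by field.
    by rewrite ler_wpM2l ?(ltW gp).
  have h3 : (nrm g)^-1 * nrm g ^+ 2 = nrm g by field.
  by rewrite h3 in h; lra.
move=> i _; rewrite /netv -/q /d /x; field.
by rewrite gn0 gt_eqF.
Qed.

Lemma linear_net n (g : 'I_n -> R) (B : R) :
  (forall z, net z -> \sum_i g i * netv z i <= B) ->
  forall x, \sum_i g i * x i <= 2 * B * nrm x.
Proof.
move=> hB x; apply: le_trans (cauchy_schwarz _ _) _.
by rewrite ler_wpM2r ?nrm_ge0 // net_sup.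
Qed.

End Nets.

Section Trilinear.
Context {R : realType}.

Lemma sum_triple n (F : 'I_n * 'I_n * 'I_n -> R) :
  \sum_t F t = \sum_i \sum_j \sum_k F (i, j, k).
Proof.
by rewrite pair_bigA pair_bigA /=; apply: eq_bigr => -[[i j] k] _.
Qed.

Lemma tri_x n S (x y z : 'I_n -> R) :
  tri S x y z = \sum_i (\sum_j \sum_k S (i, j, k) * (y j * z k)) * x i.
Proof.
rewrite /tri sum_triple; apply: eq_bigr => i _; rewrite mulr_suml.
apply: eq_bigr => j _; rewrite mulr_suml; apply: eq_bigr => k _ /=; ring.
Qed.

Lemma tri_y n S (x y z : 'I_n -> R) :
  tri S x y z = \sum_j (\sum_i \sum_k S (i, j, k) * (x i * z k)) * y j.
Proof.
rewrite /tri sum_triple exchange_big; apply: eq_bigr => j _ /=.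
rewrite mulr_suml; apply: eq_bigr => i _; rewrite mulr_suml.
by apply: eq_bigr => k _ /=; ring.
Qed.

Lemma tri_z n S (x y z : 'I_n -> R) :
  tri S x y z = \sum_k (\sum_i \sum_j S (i, j, k) * (x i * y j)) * z k.
Proof.
rewrite /tri sum_triple.
under eq_bigr do rewrite exchange_big.
rewrite exchange_big; apply: eq_bigr => k _ /=.
rewrite mulr_suml; apply: eq_bigr => i _; rewrite mulr_suml.
by apply: eq_bigr => j _ /=; ring.
Qed.

Lemma tri_net n S (B : R) :
  (forall x y z, @net R n x -> @net R n y -> @net R n z ->
     tri S (netv x) (netv y) (netv z) <= B) ->
  forall x y z : 'I_n -> R, tri S x y z <= 8 * B * nrm x * nrm y * nrm z.
Proof.
move=> hB x y z.
have -> : 8 * B * nrm x * nrm y * nrm z =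
    2 * (2 * (2 * B * nrm x) * nrm y) * nrm z by ring.
rewrite tri_z; apply: linear_net => c hc; rewrite -tri_z.
rewrite tri_y; apply: linear_net => b hb; rewrite -tri_y.
rewrite tri_x; apply: linear_net => a ha; rewrite -tri_x.
exact: hB.
Qed.

Lemma sum_triple_mul n (x y z : 'I_n -> R) :
  \sum_(t : 'I_n * 'I_n * 'I_n) x t.1.1 * y t.1.2 * z t.2 =
  (\sum_i x i) * (\sum_i y i) * (\sum_i z i).
Proof.
rewrite sum_triple -mulrA mulr_suml; apply: eq_bigr => i _ /=.
rewrite mulr_suml mulr_sumr; apply: eq_bigr => j _ /=.
by rewrite mulrA mulr_sumr.
Qed.

(** A random sign tensor has norm of order [sqrt n], on average, as a trilinear
    form on Euclidean space. *)
Lemma random_trilinear : exists C : R, 0 <= C /\ forall n : nat, (0 < n)%N ->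
  exists H : {ffun 'I_n * 'I_n * 'I_n -> bool} -> R,
   [/\ forall s, 0 <= H s,
       forall (s : {ffun 'I_n * 'I_n * 'I_n -> bool}) (x y z : 'I_n -> R), tri (fun t => sg R (s t)) x y z <= H s * nrm x * nrm y * nrm z &
       avg H <= C * Num.sqrt n%:R].
Proof.
exists (8 * 61); split; first by rewrite mulr_ge0.
move=> n n0.
set q := Num.sqrt n%:R : R.
have q0 : 0 < q by rewrite sqrtr_gt0 ltr0n.
have qq : q ^+ 2 = n%:R by rewrite sqr_sqrtr ?ler0n.
pose W := ({ffun 'I_n -> 'I_(2 * (9 * n)).+1} * {ffun 'I_n -> 'I_(2 * (9 * n)).+1}
  * {ffun 'I_n -> 'I_(2 * (9 * n)).+1})%type.
pose P (w : W) := [&& @net R n w.1.1, @net R n w.1.2 & @net R n w.2].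
pose f (s : {ffun 'I_n * 'I_n * 'I_n -> bool}) (w : W) : R :=
  tri (fun t => sg R (s t)) (netv w.1.1) (netv w.1.2) (netv w.2).
pose c : R := 60 * n%:R.
pose H s := 8 / q * (c + \sum_(w | P w) expR (q * f s w - c)).
(* Since u <= c + exp (u - c), the function H dominates the maximum over the
   net, and its average is computed from exponential moments. *)
exists H; split.
- move=> s; rewrite mulr_ge0 ?divr_ge0 ?(ltW q0) // addr_ge0 ?mulr_ge0 //.
  by apply: sumr_ge0 => w _; apply: expR_ge0.
- move=> s x y z.
  have -> : H s = 8 * ((c + \sum_(w | P w) expR (q * f s w - c)) / q).
    by rewrite /H mulrAC mulrA.
  apply: tri_net => a b d ha hb hd.
  rewrite ler_pdivlMr // mulrC.
  have Pw : P (a, b, d) by rewrite /P /= ha hb hd.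
  rewrite (bigD1 (a, b, d)) //=.
  apply: (@le_trans _ _ (c + expR (q * f s (a, b, d) - c))).
    have := expR_ge1Dx (q * f s (a, b, d) - c).
    by rewrite -[tri _ _ _ _]/(f s (a, b, d)); lra.
  rewrite lerD2l lerDl; apply: sumr_ge0 => w _; apply: expR_ge0.
have cX : (0 < #|{: {ffun 'I_n * 'I_n * 'I_n -> bool}}|)%N.
  by rewrite card_ffun expn_gt0 card_bool.
rewrite avgZ avgD avg_cst // avg_sum.
have each w : P w -> avg (fun s => expR (q * f s w - c)) <= expR (- 33 * n%:R).
  move=> /and3P[h1 h2 h3].
  rewrite (avg_eq (g := fun s : {ffun 'I_n * 'I_n * 'I_n -> bool} =>
    expR (- c) * expR (\sum_t sg R (s t) *
      (q * (netv w.1.1 t.1.1 * netv w.1.2 t.1.2 * netv w.2 t.2))))); last first.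
    move=> s; rewrite -expRD addrC; congr (expR (_ + _)).
    by rewrite /f /tri mulr_sumr; apply: eq_bigr => t _; ring.
  rewrite avgZ; apply: le_trans (ler_wpM2l (expR_ge0 _) (avg_exp_sign_le _)) _.
  rewrite -expRD ler_expR.
  rewrite (eq_bigr (fun t => n%:R * ((netv w.1.1 t.1.1) ^+ 2 * (netv w.1.2 t.1.2) ^+ 2
     * (netv w.2 t.2) ^+ 2))); last by move=> t _; rewrite -qq; ring.
  rewrite -mulr_sumr (sum_triple_mul (fun i => netv w.1.1 i ^+ 2)
    (fun i => netv w.1.2 i ^+ 2) (fun i => netv w.2 i ^+ 2)) -!nrm_sqr.
  have sq (u : 'I_n -> R) : nrm u <= 3 / 2 -> nrm u ^+ 2 <= 9 / 4.
    by have := nrm_ge0 u; nra.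
  have p12 := ler_pM (sqr_ge0 _) (sqr_ge0 _) (sq _ (net_norm h1)) (sq _ (net_norm h2)).
  have p123 := ler_pM (mulr_ge0 (sqr_ge0 _) (sqr_ge0 _)) (sqr_ge0 _) p12
    (sq _ (net_norm h3)).
  have : n%:R * (nrm (netv w.1.1) ^+ 2 * nrm (netv w.1.2) ^+ 2 * nrm (netv w.2) ^+ 2)
     <= n%:R * (9 / 4 * (9 / 4) * (9 / 4)) :> R by rewrite ler_wpM2l.
  have : (0 : R) <= n%:R by [].
  by rewrite /c; lra.
have cardP : #|P|%:R <= expR (33 * n%:R) :> R.
  have -> : #|P| = (#|@net R n| * #|@net R n| * #|@net R n|)%N.
    rewrite -!cardX; apply: eq_card => -[[a b] d]; rewrite !inE /P /=.
    by rewrite -!topredE /= andbA.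
  have -> : 33 * n%:R = 11 * n%:R + 11 * n%:R + 11 * n%:R :> R by ring.
  by rewrite !expRD !natrM !ler_pM ?mulr_ge0 ?card_net.
have total : \sum_(w | P w) avg (fun s => expR (q * f s w - c)) <= 1.
  apply: le_trans (ler_sum _ each) _.
  rewrite sumr_const -[_ *+ _]mulr_natr mulrC.
  apply: le_trans (ler_wpM2r (expR_ge0 _) cardP) _.
  by rewrite -expRD mulNr subrr expR0.
have n1 : (1 : R) <= n%:R by rewrite ler1n.
rewrite mulrAC ler_pdivrMr // -!mulrA ler_pM2l // -expr2 qq /c.
by lra.
Qed.

End Trilinear.

(** * Interpolation of trilinear forms *)

Section Interpolation.
Context {R : realType}.

Lemma sum_cos_eq0 (M k : nat) : (0 < k < M)%N ->
  \sum_(j < M) cos (j%:R * (2 * pi / M%:R * k%:R)) = 0 :> R.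
Proof.
move=> /andP[k0 kM].
have M0 : (0 : R) < M%:R by rewrite ltr0n (ltn_trans k0).
pose h : R := pi * k%:R / M%:R.
have h0 : 0 < sin h.
  apply: sin_gt0_pi; rewrite divr_gt0 ?mulr_gt0 ?pi_gt0 //= ?ltr0n //.
  by rewrite ltr_pdivrMr // ltr_pM2l ?pi_gt0 // ltr_nat.
have h2 : 2 * sin h != 0 by rewrite gt_eqF // mulr_gt0.
apply: (mulfI h2).
rewrite mulr0 mulr_sumr.
rewrite (eq_bigr (fun j : 'I_M => sin (j.+1%:R * (2 * h) - h) - sin (j%:R * (2 * h) - h))).
  rewrite -(big_mkord xpredT (fun j => sin (j.+1%:R * (2 * h) - h) - sin (j%:R * (2 * h) - h))).
  rewrite (telescope_sumr (fun j => sin (j%:R * (2 * h) - h))) // mul0r sub0r.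
  have -> : M%:R * (2 * h) - h = - h + (pi *+ 2) *+ k.
    by rewrite /h -mulr_natr -[pi *+ 2]mulr_natr; field; rewrite gt_eqF.
  by rewrite (periodicn (@sinD2pi R)) subrr.
move=> j _.
have -> : j.+1%:R * (2 * h) - h = j%:R * (2 * h) + h by rewrite -natr1; ring.
rewrite sinD sinB.
have -> : 2 * pi / M%:R * k%:R = 2 * h by rewrite /h; field; rewrite gt_eqF.
by ring.
Qed.

Lemma avg_cos (M a b : nat) : (a < M)%N -> (b < M)%N ->
  \sum_(j < M) cos (j%:R * (2 * pi / M%:R) * (a%:R - b%:R)) = (a == b)%:R * M%:R :> R.
Proof.
wlog ab : a b / (b <= a)%N.
  move=> H aM bM; have [/H|/ltnW/H] := leqP b a; first by apply.
  move/(_ bM aM); rewrite eq_sym => <-; apply: eq_bigr => j _.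
  by rewrite -cosN -mulrN opprB.
move=> aM bM; have [->|ab'] := eqVneq a b.
  rewrite (eq_bigr (fun=> 1)); last by move=> j _; rewrite subrr mulr0 cos0.
  by rewrite sumr_const card_ord mul1r.
rewrite mul0r -[RHS](@sum_cos_eq0 M (a - b)).
  by apply: eq_bigr => j _; congr cos; rewrite natrB //; ring.
rewrite subn_gt0 ltn_neqAle eq_sym ab' ab /=.
by apply: leq_ltn_trans aM; apply: leq_subr.
Qed.

(** Exponential levels: the coordinate [x] is [exp (- a / r) * xi] with
    [|xi| <= 1], where [exp (- a)] is at most a constant times [|x| ^ r] unless
    [xi = 0]. *)
Lemma exp_level (r x : R) : 0 < r -> `|x| <= 1 ->
  exists a : nat, exists xi : R,
    [/\ x = expR (- (a%:R / r)) * xi, `|xi| <= 1 &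
        expR (- a%:R) * `|xi| <= expR 1 * `|x| `^ r].
Proof.
move=> r0 x1; have [->|xn0] := eqVneq x 0.
  by exists 0%N, 0; rewrite mulr0 normr0 mulr0; split.
have xp : 0 < `|x| by rewrite normr_gt0.
pose l := - (r * ln `|x|).
have l0 : 0 <= l by rewrite oppr_ge0 mulr_ge0_le0 ?(ltW r0) ?ln_le0.
have /andP[h1 h2] := truncn_itv l0.
set a := Num.truncn l in h1 h2 *.
exists a, (expR (a%:R / r) * x).
have xE : `|x| = expR (- (l / r)).
  rewrite /l mulNr opprK mulrAC mulfV ?gt_eqF // mul1r lnK //.
have xi1 : `|expR (a%:R / r) * x| <= 1.
  rewrite normrM ger0_norm ?expR_ge0 // xE -expRD expR_le1 -mulrBl.
  by rewrite mulr_le0_ge0 ?invr_ge0 ?(ltW r0) // subr_le0.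
split => //; first by rewrite mulrA -expRD addNr expR0 mul1r.
apply: (@le_trans _ _ (expR (- a%:R) * 1)); first by rewrite ler_wpM2l ?expR_ge0.
have -> : `|x| `^ r = expR (- l).
  by rewrite /powR gt_eqF // /l opprK.
rewrite mulr1 -expRD ler_expR.
by move: h2; rewrite -natr1; lra.
Qed.

Lemma tri_le n (S : 'I_n * 'I_n * 'I_n -> R) (x y z : 'I_n -> R) :
  (forall t, `|S t| <= 1) ->
  tri S x y z <= (\sum_i `|x i|) * (\sum_i `|y i|) * (\sum_i `|z i|).
Proof.
move=> hS; rewrite -sum_triple_mul; apply: ler_sum => t _.
apply: le_trans (ler_norm _) _; rewrite !normrM -[leRHS]mul1r.
by rewrite ler_wpM2r ?mulr_ge0.
Qed.

Lemma cos3 (a b c : R) : cos (a + b + c) =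
  cos a * cos b * cos c - sin a * sin b * cos c
  - sin a * cos b * sin c - cos a * sin b * sin c.
Proof. by rewrite cosD cosD sinD; ring. Qed.

(** Riesz-Thorin interpolation, up to a constant, between the bound [1] of a
    trilinear form on [l_1] and its bound [L] on [l_2], for vectors in the unit
    ball of [l_r]. *)
Lemma interpolation_normalized (r : R) : 1 < r < 2 ->
  exists C : R, 0 <= C /\ forall n (S : 'I_n * 'I_n * 'I_n -> R) (L : R),
   (forall t, `|S t| <= 1) -> 1 <= L ->
   (forall x y z, tri S x y z <= L * nrm x * nrm y * nrm z) ->
   forall x y z : 'I_n -> R,
     \sum_i `|x i| `^ r <= 1 -> \sum_i `|y i| `^ r <= 1 ->
     \sum_i `|z i| `^ r <= 1 ->
     tri S x y z <= C * L `^ (2 * (1 - r^-1)).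
Proof.
move=> /andP[r1 r2].
have r0 : 0 < r by lra.
pose k0 := 1 - r^-1; pose k1 := r^-1 - 1 / 2.
have k0p : 0 < k0 by rewrite subr_gt0 invf_lt1.
have k1p : 0 < k1 by rewrite subr_gt0 div1r ltf_pV2 ?posrE.
pose k := Num.min k0 k1.
have kp : 0 < k by rewrite lt_min k0p.
pose K : R := expR 1.
have K0 : 0 < K by apply: expR_gt0.
have K1 : 1 <= K by have := @expR_ge1Dx R 1; rewrite -/K; lra.
exists (4 * K ^+ 3 * (2 / (1 - expR (- k)))); split.
  rewrite !mulr_ge0 ?exprn_ge0 ?(ltW K0) // invr_ge0 subr_ge0.
  by rewrite expR_le1 oppr_le0 ltW.
move=> n S L hS L1 hL x y z hx hy hz.
have lev (u : 'I_n -> R) : \sum_i `|u i| `^ r <= 1 ->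
    exists a : 'I_n -> nat, exists xi : 'I_n -> R,
    [/\ forall i, u i = expR (- ((a i)%:R / r)) * xi i,
        forall i, `|xi i| <= 1 &
        \sum_i expR (- (a i)%:R) * `|xi i| <= K].
  move=> hu.
  have u1 i : `|u i| <= 1.
    rewrite leNgt; apply/negP => ui.
    suff : 1 < \sum_i `|u i| `^ r by rewrite ltNge hu.
    rewrite (bigD1 i) //= -[ltLHS]addr0 ltr_leD //; last first.
      by apply: sumr_ge0 => j _; apply: powR_ge0.
    apply: (@le_lt_trans _ _ (1 `^ r)); first by rewrite powR1.
    by rewrite gt0_ltr_powR ?nnegrE.
  have [a ha] := boolp.choice (fun i => exp_level r0 (u1 i)).
  have [xi hxi] := boolp.choice ha.
  exists a, xi; split => [i|i|]; try by have [] := hxi i.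
  apply: (@le_trans _ _ (\sum_i K * `|u i| `^ r)).
    by apply: ler_sum => i _; have [] := hxi i.
  by rewrite -mulr_sumr -[leRHS]mulr1 ler_wpM2l // ltW.
have [a [xi [xE xi1 xiK]]] := lev _ hx.
have [b [eta [yE eta1 etaK]]] := lev _ hy.
have [c [zeta [zE zeta1 zetaK]]] := lev _ hz.
pose lv (t : 'I_n * 'I_n * 'I_n) := (a t.1.1 + b t.1.2 + c t.2)%N.
pose w (t : 'I_n * 'I_n * 'I_n) := S t * (xi t.1.1 * eta t.1.2 * zeta t.2).
pose D := (\max_t lv t).+1.
have lvD t : (lv t < D)%N by rewrite ltnS; apply: leq_bigmax.
have D0 : (0 : R) < D%:R by rewrite ltr0n.
(* The part F d of the form at level d is bounded in two ways, F1 from l_1 and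
   F2 from l_2; the weighted minimum of the two bounds decays geometrically
   away from d = 2 ln L. *)
pose F (d : nat) := \sum_(t | lv t == d) w t.
have triE : tri S x y z = \sum_(d < D) expR (- (d%:R / r)) * F d.
  rewrite /tri (partition_big (fun t => Ordinal (lvD t)) xpredT) //=.
  apply: eq_bigr => d _; rewrite mulr_sumr; apply: eq_big => [t|t /eqP <-] //.
  rewrite /w xE yE zE /= /lv !natrD !mulrDl !opprD !expRD; ring.
have F1 d : F d <= 4 * K ^+ 3 * expR d%:R.
  apply: (@le_trans _ _ (K ^+ 3 * expR d%:R)); last first.
    by rewrite -mulrA ler_peMl ?mulr_ge0 ?exprn_ge0 ?expR_ge0 ?(ltW K0) // ler1n.
  rewrite mulrC -ler_pdivrMl ?expR_gt0 // -expRN mulr_sumr.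
  apply: (@le_trans _ _ (\sum_(t | lv t == d)
     (expR (- (a t.1.1)%:R) * `|xi t.1.1|) * (expR (- (b t.1.2)%:R) * `|eta t.1.2|)
      * (expR (- (c t.2)%:R) * `|zeta t.2|))).
    apply: ler_sum => t /eqP <-; rewrite /lv !natrD !opprD !expRD.
    set A := expR _; set B := expR (- (b _)%:R); set G := expR (- (c _)%:R).
    have -> : A * `|xi t.1.1| * (B * `|eta t.1.2|) * (G * `|zeta t.2|) =
      A * B * G * (`|xi t.1.1| * `|eta t.1.2| * `|zeta t.2|) by ring.
    rewrite ler_wpM2l ?mulr_ge0 ?expR_ge0 //.
    apply: le_trans (ler_norm _) _; rewrite /w !normrM -[leRHS]mul1r.
    by rewrite ler_wpM2r ?mulr_ge0.
  apply: (@le_trans _ _ (\sum_t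
     (expR (- (a t.1.1)%:R) * `|xi t.1.1|) * (expR (- (b t.1.2)%:R) * `|eta t.1.2|)
      * (expR (- (c t.2)%:R) * `|zeta t.2|))).
    rewrite [leRHS](bigID (fun t => lv t == d)) /= lerDl.
    by apply: sumr_ge0 => t _; rewrite !mulr_ge0 ?expR_ge0.
  rewrite (sum_triple_mul (fun i => expR (- (a i)%:R) * `|xi i|)
    (fun i => expR (- (b i)%:R) * `|eta i|) (fun i => expR (- (c i)%:R) * `|zeta i|)).
  have s0 (e : 'I_n -> nat) (v : 'I_n -> R) : 0 <= \sum_i expR (- (e i)%:R) * `|v i|.
    by apply: sumr_ge0 => i _; rewrite mulr_ge0 ?expR_ge0.
  by rewrite exprS expr2 mulrA !ler_pM ?mulr_ge0.
(* A vector modulated by a function bounded by 1 has Euclidean norm at most K. *)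
have modul (e : 'I_n -> nat) (v : 'I_n -> R) (om : 'I_n -> R) :
    (forall i, `|v i| <= 1) -> \sum_i expR (- (e i)%:R) * `|v i| <= K ->
    (forall i, `|om i| <= 1) ->
    nrm (fun i => expR (- ((e i)%:R / 2)) * (om i * v i)) <= K.
  move=> v1 vK om1; apply: nrm_le; first exact: ltW.
  apply: (@le_trans _ _ K); last by rewrite expr2 ler_peMl // ltW.
  apply: le_trans vK; apply: ler_sum => i _.
  rewrite exprMn -expRM_natl.
  have -> : 2 * - ((e i)%:R / 2) = - (e i)%:R :> R by field.
  rewrite ler_wpM2l ?expR_ge0 //.
  rewrite -[leLHS]real_normK ?num_real // normrM.
  have := om1 i; have := v1 i; have := normr_ge0 (om i); have := normr_ge0 (v i).
  set p := `|om i|; set q := `|v i| => q0 p0 q1 p1.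
  have pq : p * q <= q by rewrite ler_piMl.
  have pq0 : 0 <= p * q by rewrite mulr_ge0.
  by nra.
have F2 d : (d < D)%N -> expR (- (d%:R / 2)) * F d <= 4 * K ^+ 3 * L.
  move=> dD.
  (* The level d is extracted by averaging the modulations of the three vectors
     by the D-th roots of unity; distinct levels below D are distinct modulo D. *)
  pose th j : R := j%:R * (2 * pi / D%:R).
  have -> : expR (- (d%:R / 2)) * F d =
     D%:R^-1 * \sum_(j < D) \sum_t
        cos (th j * ((lv t)%:R - d%:R)) * (expR (- ((lv t)%:R / 2)) * w t).
    rewrite exchange_big /=.
    under [in RHS]eq_bigr do rewrite -mulr_suml avg_cos //.
    rewrite mulr_sumr /F mulr_sumr big_mkcond /=; apply: eq_bigr => t _.
    case: eqP => [->|_]; last by rewrite !mul0r mulr0.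
    by rewrite mul1r mulKf // gt_eqF.
  rewrite mulrC ler_pdivrMr //.
  apply: (@le_trans _ _ (\sum_(j < D) 4 * K ^+ 3 * L)); last first.
    by rewrite sumr_const card_ord mulr_natr.
  apply: ler_sum => j _.
  pose ca i := cos (th j * (a i)%:R); pose sa i := sin (th j * (a i)%:R).
  pose cb i := cos (th j * (b i)%:R); pose sb i := sin (th j * (b i)%:R).
  pose cc i := cos (th j * ((c i)%:R - d%:R)); pose sc i := sin (th j * ((c i)%:R - d%:R)).
  pose md (e : 'I_n -> nat) (v om : 'I_n -> R) i := expR (- ((e i)%:R / 2)) * (om i * v i).
  have -> : \sum_t cos (th j * ((lv t)%:R - d%:R)) * (expR (- ((lv t)%:R / 2)) * w t) =
    tri S (md a xi ca) (md b eta cb) (md c zeta cc)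
    + (tri S (md a xi (fun i => - sa i)) (md b eta sb) (md c zeta cc)
    + (tri S (md a xi (fun i => - sa i)) (md b eta cb) (md c zeta sc)
    + tri S (md a xi (fun i => - ca i)) (md b eta sb) (md c zeta sc))).
    rewrite /tri -!big_split /=; apply: eq_bigr => t _.
    have -> : th j * ((lv t)%:R - d%:R) = th j * (a t.1.1)%:R + th j * (b t.1.2)%:R
        + th j * ((c t.2)%:R - d%:R) by rewrite /lv !natrD; ring.
    rewrite cos3 /w /lv /md !natrD !mulrDl !opprD !expRD /ca /cb /cc /sa /sb /sc; ring.
  have bd (oa ob oc : 'I_n -> R) : (forall i, `|oa i| <= 1) -> (forall i, `|ob i| <= 1) ->
     (forall i, `|oc i| <= 1) ->
     tri S (md a xi oa) (md b eta ob) (md c zeta oc) <= K ^+ 3 * L.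
    move=> ha hb hc; apply: le_trans (hL _ _ _) _.
    have -> : K ^+ 3 * L = L * K * K * K by ring.
    have L0 : 0 <= L by lra.
    rewrite !ler_pM ?mulr_ge0 ?nrm_ge0 //; exact: modul.
  have cs u : `|cos u| <= 1 :> R by apply: cos_max.
  have sn u : `|sin u| <= 1 :> R by apply: sin_max.
  have -> : 4 * K ^+ 3 * L = K ^+ 3 * L + (K ^+ 3 * L + (K ^+ 3 * L + K ^+ 3 * L)) by ring.
  by do 3?[apply: lerD]; apply: bd => i; rewrite ?normrN; (exact: cs || exact: sn).
pose D0' := 2 * ln L.
have LE : L = expR (D0' / 2) by rewrite /D0' mulrC mulKf // lnK // posrE; lra.
have -> : L `^ (2 * (1 - r^-1)) = expR (D0' * k0).
  rewrite /powR gt_eqF; last by lra.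
  by congr expR; rewrite /D0' /k0; ring.
have K3 : 0 <= 4 * K ^+ 3 by rewrite mulr_ge0 ?exprn_ge0 ?(ltW K0).
move: K3 F1 F2; set K4 := 4 * K ^+ 3 => K3 F1 F2.
clearbody D0' K4.
have hterm (d : 'I_D) : expR (- (d%:R / r)) * F d <=
    K4 * expR (D0' * k0) * expR (- (k * `|d%:R - D0'|)).
  have [dD|dD] := lerP (d%:R) D0'.
    apply: le_trans (ler_wpM2l (expR_ge0 _) (F1 d)) _.
    rewrite mulrCA -mulrA ler_wpM2l //.
    rewrite -!expRD ler_expR.
    have : k * (D0' - d%:R) <= k0 * (D0' - d%:R).
      by rewrite ler_wpM2r ?subr_ge0 // ge_min lexx.
    have -> : - (d%:R / r) + d%:R = d%:R * k0 by rewrite /k0; ring.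
    by lra.
  have -> : expR (- (d%:R / r)) = expR (- (d%:R * k1)) * expR (- (d%:R / 2)).
    by rewrite -expRD; congr expR; rewrite /k1; field; rewrite gt_eqF.
  rewrite -mulrA; apply: le_trans (ler_wpM2l (expR_ge0 _) (F2 _ (ltn_ord d))) _.
  rewrite mulrCA -mulrA ler_wpM2l //.
  rewrite {1}LE -!expRD ler_expR.
  have : k * (d%:R - D0') <= k1 * (d%:R - D0').
    by rewrite ler_wpM2r ?subr_ge0 ?(ltW dD) // ge_min lexx orbT.
  have : k0 = 1 / 2 - k1 by rewrite /k0 /k1; lra.
  by move=> ->; lra.
rewrite triE; apply: le_trans (ler_sum _ (fun d _ => hterm d)) _.
rewrite -mulr_sumr mulrAC ler_wpM2r ?expR_ge0 //.
by rewrite ler_wpM2l // sum_exp_dist.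
Qed.

End Interpolation.

(** * A random matrix with small-ball estimates *)

Section RandomMatrix.
Context {R : realType}.

(** The sample space of a random row of length [m]: [k] independent pairs of a
    multiplier in [1 .. q] and a sign vector. *)
Definition rowspace (k q m : nat) := {ffun 'I_k -> 'I_q * {ffun 'I_m -> bool}}.

(** The random row: the sum of the sign vectors weighted by their multipliers. *)
Definition rowv (k q m : nat) (w : rowspace k q m) (j : 'I_m) : R :=
  \sum_(l < k) (w l).1.+1%:R * sg R ((w l).2 j).

Lemma avg_le_cst (X : finType) (f : X -> R) (c : R) : 0 <= c ->
  (forall x, f x <= c) -> avg f <= c.
Proof.
move=> c0 fc; have [X0|X0] := posnP #|X|.
  by rewrite /avg X0 invr0 mulr0.
by apply: le_trans (avg_le fc) _; rewrite avg_cst.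
Qed.

Lemma row_dot k q m (w : rowspace k q m) (a : 'I_m -> R) :
  \sum_j rowv w j * a j =
  \sum_(l < k) (w l).1.+1%:R * \sum_j sg R ((w l).2 j) * a j.
Proof.
under eq_bigr do rewrite /rowv mulr_suml.
rewrite exchange_big; apply: eq_bigr => l _; rewrite mulr_sumr.
by apply: eq_bigr => j _; rewrite mulrA.
Qed.

(** The multiples of [X] are spaced by at least [A / 2], so at most one of them
    lies within [A / 8] of [gamma]. *)
Lemma multiplier_small_ball q (gamma X A : R) : 0 < A -> A / 2 <= `|X| ->
  avg (fun xi : 'I_q => (`|gamma - xi.+1%:R * X| <= A / 8)%R%:R) <= q%:R^-1 :> R.
Proof.
move=> A0 AX; rewrite /avg card_ord -[leRHS]mul1r ler_wpM2r ?invr_ge0 //.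
pose P (xi : 'I_q) := `|gamma - xi.+1%:R * X| <= A / 8.
have -> : \sum_xi (P xi)%:R = #|P|%:R :> R.
  rewrite -sum1_card natr_sum [RHS]big_mkcond /=.
  by apply: eq_bigr => i _; rewrite -[i \in _]/(P i); case: (P i).
rewrite (ler_nat R _ 1); apply/card_le1_eqP => x y; rewrite !unfold_in => hx hy.
apply/eqP/negPn/negP => xy.
have d1 : 1 <= `|x.+1%:R - y.+1%:R| :> R.
  have [lt_xy|le_yx] := ltnP x y.
    rewrite distrC -natrB; last by rewrite ltnS ltnW.
    by rewrite ger0_norm // ler1n subSS subn_gt0.
  rewrite -natrB; last by rewrite ltnS.
  rewrite ger0_norm // ler1n subSS subn_gt0 ltn_neqAle le_yx andbT.
  by apply: contra xy => /eqP e; apply/eqP/val_inj.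
have : `|x.+1%:R - y.+1%:R| * `|X| <= A / 4.
  rewrite -normrM mulrBl.
  have -> : x.+1%:R * X - y.+1%:R * X =
    (gamma - y.+1%:R * X) - (gamma - x.+1%:R * X) by ring.
  apply: le_trans (ler_normB _ _) _.
  by move: hx hy; rewrite /P; lra.
by have := normr_ge0 X; nra.
Qed.

(** Layer by layer: either all the signed sums are small, or one of them is
    large and its multiplier spreads the total. *)
Lemma row_small_ball k q m (a : 'I_m -> R) (A beta : R) : (0 < q)%N -> 0 < A ->
  \sum_j a j ^+ 2 = A ^+ 2 ->
  avg (fun w : rowspace k q m =>
    (`|beta - \sum_j rowv w j * a j| <= A / 8)%R%:R) <=
  (4 / 5) ^+ k + 5 / q%:R :> R.
Proof.
move=> q0 A0 hA.
rewrite (avg_eq (g := fun w : rowspace k q m => (`|beta - \sum_(l < k) (w l).1.+1%:R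
     * \sum_j sg R ((w l).2 j) * a j| <= A / 8)%R%:R)); last first.
  by move=> w; rewrite row_dot.
have q0' : (0 : R) < q%:R by rewrite ltr0n.
elim: k beta => [|k IH] beta.
  apply: avg_le_cst; first by rewrite addr_ge0 ?divr_ge0.
  move=> w; rewrite expr0; apply: (@le_trans _ _ 1); last by rewrite lerDl divr_ge0.
  by rewrite (ler_nat R _ 1) leq_b1.
pose X (s : {ffun 'I_m -> bool}) := \sum_j sg R (s j) * a j.
set p := _ + _ in IH.
have p0 : 0 <= p by rewrite addr_ge0 ?exprn_ge0 ?divr_ge0.
pose tail (g : rowspace k q m) := \sum_(l < k) (g l).1.+1%:R * X (g l).2.
rewrite avg_fcons avg_pair avg_pairC.
apply: (@le_trans _ _ (avg (fun s : {ffun 'I_m -> bool} =>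
    q%:R^-1 + p * (`|X s| < A / 2)%R%:R))).
  apply: avg_le => s.
  rewrite (avg_eq (g := fun xi : 'I_q => avg (fun g : rowspace k q m =>
     (`|beta - xi.+1%:R * X s - tail g| <= A / 8)%R%:R))); last first.
    move=> xi; apply: avg_eq => g.
    rewrite (big_ord_fcons _ _ (fun _ (e : 'I_q * {ffun 'I_m -> bool}) =>
       e.1.+1%:R * \sum_j sg R (e.2 j) * a j)) /=.
    by rewrite opprD addrA.
  have [Xs|Xs] := ltP (`|X s|) (A / 2).
    rewrite mulr1 ler_wpDl ?invr_ge0 //.
    by apply: avg_le_cst => // xi; apply: IH.
  rewrite mulr0 addr0 avg_pairC; apply: avg_le_cst; first by rewrite invr_ge0.
  move=> g; apply: le_trans (multiplier_small_ball q (beta - tail g) A0 Xs).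
  by apply: avg_le => xi; rewrite addrAC.
have c0 : (0 < #|{: {ffun 'I_m -> bool}}|)%N by rewrite card_ffun expn_gt0 card_bool.
rewrite avgD avg_cst // avgZ.
have := ler_wpM2l p0 (sign_small_ball A0 hA).
rewrite /p exprS; set B := avg _; lra.
Qed.

(** The product over the rows of [1 + K] or [1], according to whether or not the
    row takes a value within [A / 8] of its target [beta]. *)
Definition badprod k q m m' (K A : R) (beta : 'I_m' -> R) (a : 'I_m -> R)
    (w : {ffun 'I_m' -> rowspace k q m}) : R :=
  \prod_i (1 + K * (`|beta i - \sum_j rowv (w i) j * a j| <= A / 8)%R%:R).

Lemma badprod_ge0 k q m m' (K A : R) beta a (w : {ffun 'I_m' -> rowspace k q m}) :
  0 <= K -> 0 <= badprod K A beta a w.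
Proof. by move=> K0; apply: prodr_ge0 => i _; rewrite addr_ge0 ?mulr_ge0. Qed.

Lemma avg_badprod k q m m' (K A : R) (beta : 'I_m' -> R) (a : 'I_m -> R) :
  (0 < q)%N -> 0 < A -> nrm a = A -> 0 <= K -> K * ((4 / 5) ^+ k + 5 / q%:R) <= 1 ->
  avg (@badprod k q m m' K A beta a) <= 2 ^+ m'.
Proof.
move=> q0 A0 hA K0 hK.
rewrite (avg_ffun_prod (fun i (e : rowspace k q m) =>
  1 + K * (`|beta i - \sum_j rowv e j * a j| <= A / 8)%R%:R)).
rewrite -[m' in leRHS]card_ord -prodr_const; apply: ler_prod => i _.
have c0 : (0 < #|{: rowspace k q m}|)%N.
  by rewrite card_ffun expn_gt0 card_prod card_ord muln_gt0 q0 card_ffun expn_gt0 card_bool.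
rewrite avg_ge0 => [|e]; last by rewrite addr_ge0 ?mulr_ge0.
rewrite avgD avg_cst // avgZ /=.
have hA2 : \sum_j a j ^+ 2 = A ^+ 2 by rewrite -nrm_sqr hA.
have := ler_wpM2l K0 (row_small_ball k (beta i) q0 A0 hA2).
by set B := avg _; lra.
Qed.

(** If the product is less than $(1 + K)^{m'/2}$, then at least half of the rows
    satisfy the small-ball estimate. *)
Lemma badprod_lower k q m m' (K A : R) (beta : 'I_m' -> R) (a : 'I_m -> R)
    (w : {ffun 'I_m' -> rowspace k q m}) : 0 <= K -> 0 < A ->
  badprod K A beta a w ^+ 2 < (1 + K) ^+ m' ->
  m'%:R / 2 * (A / 8) ^+ 2 <= \sum_i (beta i - \sum_j rowv (w i) j * a j) ^+ 2.
Proof.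
move=> K0 A0 hlt.
pose P (i : 'I_m') := `|beta i - \sum_j rowv (w i) j * a j| <= A / 8.
have bE : badprod K A beta a w = (1 + K) ^+ #|P|.
  rewrite -prodr_const big_mkcond /=; apply: eq_bigr => i _.
  by rewrite unfold_in -/(P i); case: (P i); rewrite ?mulr1 // mulr0 addr0.
have K1 : 1 <= 1 + K by rewrite lerDl.
have c2 : (2 * #|P| < m')%N.
  rewrite ltnNge; apply/negP => h.
  move: hlt; rewrite bE -exprM mulnC ltNge => /negP; apply.
  by apply: ler_weXn2l.
have cC : (#|P| + #|predC P| = m')%N by rewrite cardC card_ord.
have cC2 : m'%:R / 2 <= #|predC P|%:R :> R.
  rewrite ler_pdivrMr // -natrM ler_nat.
  have half u v t : (u + v = t -> 2 * u < t -> t <= v * 2)%N.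
    by move=> <-; rewrite mul2n -addnn ltn_add2l muln2 -addnn leq_add2r => /ltnW.
  exact: half cC c2.
rewrite (bigID P) /= -[leLHS]add0r lerD //.
  by apply: sumr_ge0 => i _; apply: sqr_ge0.
apply: (@le_trans _ _ (#|predC P|%:R * (A / 8) ^+ 2)).
  by rewrite ler_wpM2r ?sqr_ge0.
rewrite mulr_natl -sumr_const; apply: ler_sum => i.
rewrite inE /= -ltNge => h.
rewrite -[leRHS]real_normK ?num_real // lerXn2r ?nnegrE ?divr_ge0 ?(ltW A0) //.
exact: ltW.
Qed.

Lemma avg_exp_row k q m (tau : R) (x : 'I_m -> R) :
  avg (fun w : rowspace k q m => expR (tau * \sum_j rowv w j * x j)) <=
  expR (2 * (k * q ^ 2)%:R * tau ^+ 2 * nrm x ^+ 2).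
Proof.
rewrite (avg_eq (g := fun w : rowspace k q m => \prod_l
  expR (tau * ((w l).1.+1%:R * \sum_j sg R ((w l).2 j) * x j)))); last first.
  by move=> w; rewrite row_dot mulr_sumr expR_sum.
rewrite (avg_ffun_prod (fun _ (e : 'I_q * {ffun 'I_m -> bool}) =>
  expR (tau * (e.1.+1%:R * \sum_j sg R (e.2 j) * x j)))).
have -> : expR (2 * (k * q ^ 2)%:R * tau ^+ 2 * nrm x ^+ 2) =
  \prod_(l < k) expR (2 * (q ^ 2)%:R * tau ^+ 2 * nrm x ^+ 2).
  rewrite prodr_const card_ord -expRM_natl; congr expR.
  by rewrite natrM; ring.
apply: ler_prod => l _; rewrite avg_ge0 => [|e]; last exact: expR_ge0.
rewrite avg_pair /=; apply: avg_le_cst => [|xi]; first exact: expR_ge0.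
rewrite (avg_eq (g := fun s : {ffun 'I_m -> bool} =>
  expR (\sum_j sg R (s j) * (tau * xi.+1%:R * x j)))); last first.
  move=> s; congr expR; rewrite mulrA mulr_sumr.
  by apply: eq_bigr => j _; rewrite mulrCA.
apply: le_trans (avg_exp_sign_le _) _.
have -> : 2 * (q ^ 2)%:R * tau ^+ 2 * nrm x ^+ 2 =
  2 * ((q ^ 2)%:R * (tau ^+ 2 * nrm x ^+ 2)) by ring.
rewrite ler_expR ler_pM2l //.
under eq_bigr do rewrite exprMn.
rewrite -mulr_sumr -nrm_sqr [leRHS]mulrA ler_wpM2r ?sqr_ge0 //.
rewrite exprMn mulrC ler_wpM2r ?sqr_ge0 //.
by rewrite -natrX ler_nat leq_exp2r.
Qed.

Lemma avg_exp_rows k q m m' (lam : R) (x : 'I_m -> R) (y : 'I_m' -> R) :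
  avg (fun w : {ffun 'I_m' -> rowspace k q m} =>
    expR (lam * \sum_i y i * \sum_j rowv (w i) j * x j)) <=
  expR (2 * (k * q ^ 2)%:R * lam ^+ 2 * (nrm x ^+ 2 * nrm y ^+ 2)).
Proof.
rewrite (avg_eq (g := fun w : {ffun 'I_m' -> rowspace k q m} => \prod_i
  expR ((lam * y i) * \sum_j rowv (w i) j * x j))); last first.
  move=> w; rewrite mulr_sumr expR_sum.
  by apply: eq_bigr => i _; rewrite mulrA.
rewrite (avg_ffun_prod (fun i (e : rowspace k q m) =>
  expR ((lam * y i) * \sum_j rowv e j * x j))).
rewrite [nrm y ^+ 2]nrm_sqr !mulr_sumr expR_sum; apply: ler_prod => i _.
rewrite avg_ge0 => [|e]; last exact: expR_ge0.
apply: le_trans (avg_exp_row _ _ _ _) _.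
by rewrite ler_expR le_eqVlt exprMn; apply/orP; left; apply/eqP; ring.
Qed.

End RandomMatrix.

Section MatrixExistence.
Context {R : realType}.

Lemma bilinear_net m1 m2 (G : 'I_m1 -> 'I_m2 -> R) (B : R) :
  (forall x y, @net R m1 x -> @net R m2 y ->
     \sum_j \sum_i netv x j * G j i * netv y i <= B) ->
  forall x y, \sum_j \sum_i x j * G j i * y i <= 4 * B * nrm x * nrm y.
Proof.
move=> hB x y.
have ey (x' : 'I_m1 -> R) (y' : 'I_m2 -> R) : \sum_j \sum_i x' j * G j i * y' i =
    \sum_i (\sum_j x' j * G j i) * y' i.
  by rewrite exchange_big; apply: eq_bigr => i _; rewrite mulr_suml.
have ex (x' : 'I_m1 -> R) (y' : 'I_m2 -> R) : \sum_j \sum_i x' j * G j i * y' i =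
    \sum_j (\sum_i G j i * y' i) * x' j.
  apply: eq_bigr => j _; rewrite mulr_suml.
  by apply: eq_bigr => i _; ring.
have -> : 4 * B * nrm x * nrm y = 2 * (2 * B * nrm x) * nrm y by ring.
rewrite ey; apply: linear_net => b hb; rewrite -ey.
by rewrite ex; apply: linear_net => a ha; rewrite -ex; apply: hB.
Qed.

(** With as many layers as multipliers, the small-ball probability of
    [row_small_ball] can be made at most [1 / K]. *)
Lemma small_ball_parameters (K : R) : 0 < K ->
  exists2 q : nat, (0 < q)%N & K * ((4 / 5) ^+ q + 5 / q%:R) <= 1.
Proof.
move=> K0; pose q := (Num.truncn (10 * K)).+1.
have /andP[_ hq] := truncn_itv (mulr_ge0 (ler0n R 10) (ltW K0)).
exists q => //.
have q0 : (0 : R) < q%:R by rewrite ltr0n.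
have hq' : 10 * K <= q%:R by apply: ltW.
have h5 : 5 / q%:R <= 1 / (2 * K).
  by rewrite ler_pdivrMr // div1r mulrC ler_pdivlMr ?mulr_gt0 //; lra.
have h4 : (4 / 5) ^+ q <= 1 / (2 * K).
  apply: (@le_trans _ _ (expR (- (q%:R / 5)))).
    have -> : - (q%:R / 5) = q%:R * - (1 / 5) :> R by field.
    rewrite expRM_natl; apply: lerXn2r; rewrite ?nnegrE ?expR_ge0 ?divr_ge0 //.
    by have := @expR_ge1Dx R (- (1 / 5)); lra.
  rewrite expRN div1r lef_pV2 ?posrE ?expR_gt0 ?mulr_gt0 //.
  by have := @expR_ge1Dx R (q%:R / 5); lra.
apply: (@le_trans _ _ (K * (1 / (2 * K) + 1 / (2 * K)))).
  by rewrite ler_pM2l // lerD.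
by rewrite le_eqVlt; apply/orP; left; apply/eqP; field; rewrite gt_eqF.
Qed.

Lemma avg_pair_mul (X Y : finType) (f : X -> R) (g : Y -> R) :
  avg (fun p : X * Y => f p.1 * g p.2) = avg f * avg g.
Proof.
rewrite avg_pair /= (avg_eq (g := fun x => avg g * f x)) ?avgZ 1?mulrC //.
by move=> x; rewrite avgZ mulrC.
Qed.

(** Existence of a matrix of bounded norm such that exponentially many given
    vectors $(a_v, b_v)$ stay away from its graph and from the orthogonal
    complement of its graph. *)
Lemma random_matrix (kappa : R) : 0 <= kappa -> exists L : R, 0 <= L /\
  forall (m1 m2 : nat) (V : finType) (P : pred V)
    (a : V -> 'I_m1 -> R) (b : V -> 'I_m2 -> R),
  (0 < m1)%N -> (m1 <= m2 <= m1.+1)%N ->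
  #|P|%:R <= expR (kappa * (m1 + m2)%:R) ->
  exists G : 'I_m1 -> 'I_m2 -> R,
  [/\ forall x y, \sum_j \sum_i x j * G j i * y i <= L * nrm x * nrm y,
      forall v, P v ->
        nrm (a v) <= 20 * nrm (fun i => b v i - \sum_j a v j * G j i) &
      forall v, P v ->
        nrm (b v) <= 20 * nrm (fun j => a v j + \sum_i G j i * b v i)].
Proof.
move=> kap0; pose K := 64 * expR (6 * kappa).
have K0 : 0 < K by rewrite mulr_gt0 ?expR_gt0.
have [q q0 hq] := small_ball_parameters K0.
pose Q : R := (q * q ^ 2)%:R.
have Q0 : 0 <= Q by [].
exists (4 * (21 * Q + 13)); split; first by rewrite mulr_ge0 ?addr_ge0 ?mulr_ge0.
move=> m1 m2 V P a b m10 /andP[m12 m21] hP.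
have m20 : (0 < m2)%N by apply: leq_trans m12.
set N := (m1 + m2)%N in hP *.
have N0 : (0 : R) < N%:R by rewrite ltr0n addn_gt0 m10.
set s := Num.sqrt N%:R : R.
have s0 : 0 < s by rewrite sqrtr_gt0.
have ss : s ^+ 2 = N%:R by rewrite sqr_sqrtr // ltW.
set EK := expR (kappa * N%:R) in hP.
have EK0 : 0 < EK by apply: expR_gt0.
pose O1 := {ffun 'I_m2 -> rowspace q q m1}.
pose O2 := {ffun 'I_m1 -> rowspace q q m2}.
pose bet1 v (w2 : O2) i := s * b v i - \sum_j a v j * rowv (w2 j) i : R.
pose bet2 v (w1 : O1) j := - (s * a v j) - \sum_i rowv (w1 i) j * b v i : R.
(* Z1 and Z2 count, with weights, the vectors too close to the graph and to its
   orthogonal complement; Z3 controls the operator norm. *)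
pose Z1 (w : O1 * O2) := \sum_(v | P v && (nrm (a v) != 0))
   (EK * 2 ^+ m2)^-1 * badprod K (nrm (a v)) (bet1 v w.2) (a v) w.1.
pose Z2 (w : O1 * O2) := \sum_(v | P v && (nrm (b v) != 0))
   (EK * 2 ^+ m1)^-1 * badprod K (nrm (b v)) (bet2 v w.1) (b v) w.2.
pose c := (21 * Q + 11) * N%:R.
pose f1 x y (w1 : O1) := \sum_i y i * \sum_j rowv (w1 i) j * x j : R.
pose f2 x y (w2 : O2) := \sum_j x j * \sum_i rowv (w2 j) i * y i : R.
pose D := ({ffun 'I_m1 -> 'I_(2 * (9 * m1)).+1} * {ffun 'I_m2 -> 'I_(2 * (9 * m2)).+1})%type.
pose Z3 (w : O1 * O2) := \sum_(d : D | @net R m1 d.1 && @net R m2 d.2)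
   expR (- c) * (expR (s * f1 (netv d.1) (netv d.2) w.1)
                 * expR (s * f2 (netv d.1) (netv d.2) w.2)).
have sub (P' : pred V) : (forall v, P' v -> P v) -> #|P'|%:R <= EK.
  move=> h; apply: le_trans hP; rewrite ler_nat; apply: subset_leq_card.
  by apply/fintype.subsetP => v; apply: h.
have avgZ1 : avg Z1 <= 1.
  rewrite avg_sum.
  apply: (@le_trans _ _ (\sum_(v | P v && (nrm (a v) != 0)) EK^-1)).
    apply: ler_sum => v /andP[_ av0].
    have avp : 0 < nrm (a v) by rewrite lt_def av0 nrm_ge0.
    rewrite avgZ invfM -mulrA ler_piMr ?invr_ge0 ?(ltW EK0) //.
    rewrite mulrC ler_pdivrMr ?exprn_gt0 // mul1r avg_pair avg_pairC.
    apply: avg_le_cst => [|w2]; first by rewrite exprn_ge0.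
    by apply: (avg_badprod (bet1 v w2)) => //; apply: ltW.
  rewrite sumr_const -[_ *+ _]mulr_natr mulrC ler_pdivrMr // mul1r.
  by apply: sub => v /andP[].
have avgZ2 : avg Z2 <= 1.
  rewrite avg_sum.
  apply: (@le_trans _ _ (\sum_(v | P v && (nrm (b v) != 0)) EK^-1)).
    apply: ler_sum => v /andP[_ bv0].
    have bvp : 0 < nrm (b v) by rewrite lt_def bv0 nrm_ge0.
    rewrite avgZ invfM -mulrA ler_piMr ?invr_ge0 ?(ltW EK0) //.
    rewrite mulrC ler_pdivrMr ?exprn_gt0 // mul1r avg_pair.
    apply: avg_le_cst => [|w1]; first by rewrite exprn_ge0.
    by apply: (avg_badprod (bet2 v w1)) => //; apply: ltW.
  rewrite sumr_const -[_ *+ _]mulr_natr mulrC ler_pdivrMr // mul1r.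
  by apply: sub => v /andP[].
have avgZ3 : avg Z3 <= 1.
  rewrite avg_sum.
  apply: (@le_trans _ _ (\sum_(d : D | @net R m1 d.1 && @net R m2 d.2)
      expR (- (11 * N%:R)))).
    apply: ler_sum => d /andP[h1 h2].
    rewrite avgZ (avg_pair_mul (fun w => expR (s * f1 (netv d.1) (netv d.2) w))
      (fun w => expR (s * f2 (netv d.1) (netv d.2) w))).
    have e1 := avg_exp_rows q q s (netv d.1) (netv d.2).
    have e2 := avg_exp_rows q q s (netv d.2) (netv d.1).
    have := ler_pM (avg_ge0 (fun w => expR_ge0 (s * f1 (netv d.1) (netv d.2) w)))
      (avg_ge0 (fun w => expR_ge0 (s * f2 (netv d.1) (netv d.2) w))) e1 e2.
    move/(ler_wpM2l (expR_ge0 (- c))) => /le_trans; apply.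
    rewrite -!expRD ler_expR -/Q ss /c.
    have n1 := net_norm h1; have n2 := net_norm h2.
    have sq m (u : 'I_m -> R) : nrm u <= 3 / 2 -> nrm u ^+ 2 <= 9 / 4.
      by have := nrm_ge0 u; nra.
    have := ler_pM (sqr_ge0 _) (sqr_ge0 _) (sq _ _ n1) (sq _ _ n2).
    rewrite [nrm (netv d.2) ^+ 2 * _]mulrC; set p := _ * nrm (netv d.2) ^+ 2 => hp.
    have : Q * N%:R * p <= Q * N%:R * (9 / 4 * (9 / 4)).
      by rewrite ler_wpM2l ?mulr_ge0 // ltW.
    have : 0 <= Q * N%:R by rewrite mulr_ge0 // ltW.
    by lra.
  rewrite sumr_const -[_ *+ _]mulr_natr mulrC.
  have -> : #|[pred d : D | @net R m1 d.1 && @net R m2 d.2]| =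
      (#|@net R m1| * #|@net R m2|)%N.
    by rewrite -cardX; apply: eq_card => -[x y]; rewrite !inE.
  rewrite natrM expRN ler_pdivrMr ?expR_gt0 // mul1r /N natrD mulrDr expRD.
  by rewrite ler_pM ?card_net.
have c0 : (0 < #|{: O1 * O2}|)%N.
  rewrite card_prod !card_ffun !card_prod !card_ffun !card_ord card_bool.
  by rewrite !muln_gt0 !expn_gt0 !muln_gt0 !expn_gt0 q0.
have [[w1 w2]] := exists_le_avg (fun w => Z1 w + (Z2 w + Z3 w)) c0.
rewrite !avgD => hw.
have tZ1 (v : V) : P v && (nrm (a v) != 0) ->
    0 <= (EK * 2 ^+ m2)^-1 * badprod K (nrm (a v)) (bet1 v w2) (a v) w1.
  by move=> _; rewrite mulr_ge0 ?badprod_ge0 ?invr_ge0 ?mulr_ge0 ?exprn_ge0 // ltW.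
have tZ2 (v : V) : P v && (nrm (b v) != 0) ->
    0 <= (EK * 2 ^+ m1)^-1 * badprod K (nrm (b v)) (bet2 v w1) (b v) w2.
  by move=> _; rewrite mulr_ge0 ?badprod_ge0 ?invr_ge0 ?mulr_ge0 ?exprn_ge0 // ltW.
have tZ3 (d : D) : @net R m1 d.1 && @net R m2 d.2 ->
    0 <= expR (- c) * (expR (s * f1 (netv d.1) (netv d.2) w1)
                 * expR (s * f2 (netv d.1) (netv d.2) w2)).
  by move=> _; rewrite !mulr_ge0 ?expR_ge0.
have Z10 : 0 <= Z1 (w1, w2) by apply: sumr_ge0.
have Z20 : 0 <= Z2 (w1, w2) by apply: sumr_ge0.
have Z30 : 0 <= Z3 (w1, w2) by apply: sumr_ge0.
have Z13 : Z1 (w1, w2) <= 3 by lra.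
have Z23 : Z2 (w1, w2) <= 3 by lra.
have Z33 : Z3 (w1, w2) <= 3 by lra.
pose G j i := (rowv (w1 i) j + rowv (w2 j) i) / s.
(* The arithmetic of the union bound, using that m1 + m2 <= 3 m. *)
have union (m : nat) (B : R) : (0 < m)%N -> (N <= 3 * m)%N -> 0 <= B ->
    (EK * 2 ^+ m)^-1 * B <= 3 -> B ^+ 2 < (1 + K) ^+ m.
  move=> m0 Nm B0; rewrite mulrC ler_pdivrMr ?mulr_gt0 ?exprn_gt0 // => hB.
  apply: (@le_lt_trans _ _ ((36 * expR (6 * kappa)) ^+ m)).
    apply: (@le_trans _ _ ((3 * (EK * 2 ^+ m)) ^+ 2)).
      by rewrite lerXn2r ?nnegrE ?mulr_ge0 ?exprn_ge0 ?(ltW EK0).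
    have -> : (3 * (EK * 2 ^+ m)) ^+ 2 = 9 * EK ^+ 2 * (2 ^+ 2) ^+ m.
      have e2 : (2 ^+ 2) ^+ m = (2 ^+ m) ^+ 2 :> R by rewrite -!exprM mulnC.
      by rewrite e2; ring.
    have -> : (36 * expR (6 * kappa)) ^+ m =
        9 ^+ m * expR (6 * kappa) ^+ m * (2 ^+ 2) ^+ m.
      by rewrite -!exprMn; congr (_ ^+ m); ring.
    rewrite ler_wpM2r ?exprn_ge0 ?sqr_ge0 //.
    apply: ler_pM; rewrite ?sqr_ge0 //.
      apply: (@le_trans _ _ (9 ^+ 1)); first by rewrite expr1.
      by apply: ler_weXn2l; rewrite ?ler1n.
    rewrite /EK -expRM_natl -[leRHS]expRM_natl ler_expR.
    have : kappa * N%:R <= kappa * (3 * m)%:R by rewrite ler_wpM2l // ler_nat.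
    by rewrite natrM; lra.
  have e6 := expR_gt0 (6 * kappa).
  rewrite ltrXn2r ?lt0n_neq0 ?nnegrE ?mulr_ge0 ?addr_ge0 ?expR_ge0 //.
  by rewrite /K; lra.
have Nm1 : (N <= 3 * m1)%N.
  rewrite /N mulSn leq_add2l (leq_trans m21) // mul2n -addnn -addn1 leq_add2l //.
have Nm2 : (N <= 3 * m2)%N.
  by rewrite /N mulSn leq_add // leq_pmull.
(* The estimate of badprod_lower, scaled by s. *)
have scale (m : nat) (A : R) (u u' : 'I_m -> R) : (N <= 3 * m)%N -> 0 < A ->
    (forall i, u' i ^+ 2 = s ^+ 2 * u i ^+ 2) ->
    m%:R / 2 * (A / 8) ^+ 2 <= \sum_i u' i ^+ 2 -> A <= 20 * nrm u.
  move=> Nm A0 hu; under eq_bigr do rewrite hu.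
  rewrite -mulr_sumr -nrm_sqr ss => h.
  rewrite -ler_sqr ?nnegrE ?mulr_ge0 ?nrm_ge0 ?(ltW A0) // exprMn.
  have Nm' : N%:R <= 3 * m%:R :> R by rewrite -natrM ler_nat.
  rewrite -(ler_pM2l N0).
  have : N%:R * A ^+ 2 <= 3 * m%:R * A ^+ 2 by rewrite ler_wpM2r ?sqr_ge0.
  have -> : N%:R * (20 ^+ 2 * nrm u ^+ 2) = 400 * (N%:R * nrm u ^+ 2) by ring.
  have e : m%:R / 2 * (A / 8) ^+ 2 = (m%:R * A ^+ 2) / 128 by field.
  rewrite e in h.
  have : 0 <= m%:R * A ^+ 2 by rewrite mulr_ge0 ?sqr_ge0.
  by lra.
have sn0 : s != 0 by rewrite gt_eqF.
exists G; split.
- move=> x y; rewrite -[4 * _]/(4 * _).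
  apply: bilinear_net => x' y' hx hy.
  have fE : \sum_j \sum_i netv x' j * G j i * netv y' i =
     s^-1 * (f1 (netv x') (netv y') w1 + f2 (netv x') (netv y') w2).
    rewrite /f1 /f2 exchange_big mulrDr !mulr_sumr.
    rewrite (eq_bigr (fun i => s^-1 * (netv y' i * \sum_j rowv (w1 i) j * netv x' j) +
       \sum_j s^-1 * (netv x' j * (rowv (w2 j) i * netv y' i)))); last first.
      move=> i _; rewrite !mulr_sumr -big_split /=; apply: eq_bigr => j _.
      by rewrite /G; ring.
    rewrite big_split /=; congr (_ + _); rewrite exchange_big.
    by apply: eq_bigr => j _; rewrite -mulr_sumr -mulr_sumr.
  have hd : @net R m1 (x', y').1 && @net R m2 (x', y').2 by rewrite /= hx hy.
  have h3 : expR (- c) * (expR (s * f1 (netv x') (netv y') w1)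
                 * expR (s * f2 (netv x') (netv y') w2)) <= 3.
    apply: le_trans Z33; rewrite /Z3 (bigD1 (x', y')) //= lerDl.
    by apply: sumr_ge0 => d /andP[hd' _]; apply: tZ3.
  rewrite -!expRD -mulrDr in h3.
  have := le_trans (expR_ge1Dx _) h3.
  rewrite /c => h4; rewrite fE [leLHS]mulrC ler_pdivrMr //.
  rewrite -(ler_pM2l s0).
  have -> : s * ((21 * Q + 13) * s) = (21 * Q + 13) * N%:R by rewrite -ss; ring.
  have : 1 <= N%:R :> R by rewrite ler1n -(ltr0n R).
  by lra.
- move=> v Pv; have [->|av0] := eqVneq (nrm (a v)) 0.
    by rewrite mulr_ge0 ?nrm_ge0.
  have avp : 0 < nrm (a v) by rewrite lt_def av0 nrm_ge0.
  have hb : (EK * 2 ^+ m2)^-1 * badprod K (nrm (a v)) (bet1 v w2) (a v) w1 <= 3.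
    apply: le_trans Z13; rewrite /Z1 (bigD1 v) ?Pv //= lerDl.
    by apply: sumr_ge0 => d /andP[hd' _]; apply: tZ1.
  have := union m2 _ m20 Nm2 (badprod_ge0 _ _ _ _ (ltW K0)) hb.
  move/(badprod_lower (ltW K0) avp).
  apply: (scale m2 _ _ _ Nm2 avp) => i.
  rewrite -exprMn; congr (_ ^+ 2); rewrite /bet1 mulrBr -[LHS]addrA -opprD; congr (_ - _).
  rewrite mulr_sumr -big_split /=; apply: eq_bigr => j _.
  by rewrite /G; field.
- move=> v Pv; have [->|bv0] := eqVneq (nrm (b v)) 0.
    by rewrite mulr_ge0 ?nrm_ge0.
  have bvp : 0 < nrm (b v) by rewrite lt_def bv0 nrm_ge0.
  have hb : (EK * 2 ^+ m1)^-1 * badprod K (nrm (b v)) (bet2 v w1) (b v) w2 <= 3.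
    apply: le_trans Z23; rewrite /Z2 (bigD1 v) ?Pv //= lerDl.
    by apply: sumr_ge0 => d /andP[hd' _]; apply: tZ2.
  have := union m1 _ m10 Nm1 (badprod_ge0 _ _ _ _ (ltW K0)) hb.
  move/(badprod_lower (ltW K0) bvp).
  apply: (scale m1 _ _ _ Nm1 bvp) => j.
  rewrite -exprMn -[RHS]sqrrN; congr (_ ^+ 2).
  rewrite /bet2 mulrDr -[LHS]addrA -!opprD; congr (- (_ + _)).
  rewrite mulr_sumr -big_split /=; apply: eq_bigr => i _.
  by rewrite /G; field.
Qed.

End MatrixExistence.

(** * Kashin decomposition of an abstract norm *)

Section KashinCore.
Context {R : realType}.

Lemma nrm_sum (I J : finType) (u : I + J -> R) :
  nrm u ^+ 2 = nrm (fun i => u (inl i)) ^+ 2 + nrm (fun j => u (inr j)) ^+ 2.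
Proof. by rewrite !nrm_sqr big_sumType. Qed.

Lemma nrm_inl_le (I J : finType) (u : I + J -> R) : nrm (fun i => u (inl i)) <= nrm u.
Proof.
by rewrite -ler_sqr ?nnegrE ?nrm_ge0 // nrm_sum lerDl sqr_ge0.
Qed.

Lemma nrm_inr_le (I J : finType) (u : I + J -> R) : nrm (fun i => u (inr i)) <= nrm u.
Proof.
by rewrite -ler_sqr ?nnegrE ?nrm_ge0 // nrm_sum lerDr sqr_ge0.
Qed.

Lemma nrm_le_sum (I J : finType) (u : I + J -> R) :
  nrm u <= nrm (fun i => u (inl i)) + nrm (fun j => u (inr j)).
Proof.
apply: nrm_le; first by rewrite addr_ge0 ?nrm_ge0.
rewrite -nrm_sqr nrm_sum sqrrD -addrA lerD2l lerDr.
by rewrite mulrn_wge0 // mulr_ge0 ?nrm_ge0.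
Qed.

Lemma nrm_row_le m1 m2 (G : 'I_m1 -> 'I_m2 -> R) (L : R) : 0 <= L ->
  (forall x y, \sum_j \sum_i x j * G j i * y i <= L * nrm x * nrm y) ->
  forall x, nrm (fun i => \sum_j x j * G j i) <= L * nrm x.
Proof.
move=> L0 hG x; set y := fun i => _.
have [->|y0] := eqVneq (nrm y) 0; first by rewrite mulr_ge0 ?nrm_ge0.
have yp : 0 < nrm y by rewrite lt_def y0 nrm_ge0.
rewrite -(ler_pM2r yp) -expr2 nrm_sqr; apply: le_trans (hG x y).
rewrite exchange_big; apply: ler_sum => i _.
by rewrite expr2 {1}/y mulr_suml.
Qed.

Lemma nrm_col_le m1 m2 (G : 'I_m1 -> 'I_m2 -> R) (L : R) : 0 <= L ->
  (forall x y, \sum_j \sum_i x j * G j i * y i <= L * nrm x * nrm y) ->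
  forall y, nrm (fun j => \sum_i G j i * y i) <= L * nrm y.
Proof.
move=> L0 hG y.
rewrite (nrm_eq (v := fun j => \sum_i y i * G j i)); last first.
  by move=> j; apply: eq_bigr => i _; rewrite mulrC.
apply: (@nrm_row_le m2 m1 (fun i j => G j i)) => // a b.
rewrite exchange_big mulrAC; apply: le_trans (hG b a).
apply: ler_sum => j _; apply: ler_sum => i _.
by rewrite le_eqVlt; apply/orP; left; apply/eqP; ring.
Qed.

(** If [nu <= rho |.|], and the sign vectors have dual norms at most [H s] with
    average $O(\sqrt N / \rho)$, then [nu] is at least a multiple of [rho |.|]
    on the graph of some matrix [G] and on its orthogonal complement. A vector
    [u] violating the estimate is rescaled and rounded to an integer vector,
    which belongs to a set of at most [exp (kappa N)] integer points. *)
Lemma kashin_core (C0 : R) : 0 <= C0 -> exists L c : R, [/\ 0 <= L, 0 < c &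
  forall (m1 m2 : nat) (nu : ('I_m1 + 'I_m2 -> R) -> R) (rho : R)
    (H : {ffun 'I_m1 + 'I_m2 -> bool} -> R),
  (m1 <= m2 <= m1.+1)%N -> 0 < rho ->
  (forall u, 0 <= nu u) -> (forall u, nu u <= rho * nrm u) ->
  (forall s, 0 <= H s) ->
  (forall (s : {ffun 'I_m1 + 'I_m2 -> bool}) u, \sum_t sg R (s t) * u t <= H s * nu u) ->
  avg H <= C0 * Num.sqrt (m1 + m2)%:R / rho ->
  exists G : 'I_m1 -> 'I_m2 -> R,
  [/\ forall x y, \sum_j \sum_i x j * G j i * y i <= L * nrm x * nrm y,
      forall u, (forall i, u (inr i) = \sum_j u (inl j) * G j i) ->
        c * rho * nrm u <= nu u &
      forall u, (forall j, u (inl j) = - \sum_i G j i * u (inr i)) ->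
        c * rho * nrm u <= nu u]].
Proof.
move=> C00; pose kappa := 2 + 2 * C0.
have kap0 : 0 <= kappa by rewrite /kappa; lra.
have [L [L0 hL]] := random_matrix kap0.
pose R0 := 21 * (1 + L) ^+ 2 + 2.
have R00 : 0 < R0.
  by rewrite /R0; have := sqr_ge0 (1 + L); lra.
pose c := Num.min R0^-1 (2 * C0 + 1)^-1.
have c0 : 0 < c by rewrite lt_min !invr_gt0 R00 /=; lra.
have cR : c <= R0^-1 by rewrite ge_min lexx.
have cC : c <= (2 * C0 + 1)^-1 by rewrite ge_min lexx orbT.
exists L, c; split => // m1 m2 nu rho H m12 rho0 nu0 nurho H0 hH avgH.
have T : #|{: 'I_m1 + 'I_m2}| = (m1 + m2)%N by rewrite card_sum !card_ord.
have [m10|m10] := posnP m1.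
  (* In dimension at most one every vector satisfies the estimate. *)
  have small u : c * rho * nrm u <= nu u.
    have T1 : (#|{: 'I_m1 + 'I_m2}| <= 1)%N by case/andP: m12; rewrite T m10.
    have [u0|un0] := eqVneq (nrm u) 0; first by rewrite u0 mulr0.
    have up : 0 < nrm u by rewrite lt_def un0 nrm_ge0.
    have [t t0] : exists t, u t != 0.
      apply/existsP; apply: contra_neqT un0 => /existsPn hu.
      by rewrite /nrm big1 ?sqrtr0 // => t _; have := hu t; rewrite negbK => /eqP->;
         rewrite expr0n.
    have all1 t' : t' = t by move/card_le1_eqP: T1; apply.
    have N1 : (m1 + m2)%N = 1%N.
      apply/eqP; rewrite -T eqn_leq T1 /=; apply/card_gt0P; by exists t.
    pose s := [ffun t' : 'I_m1 + 'I_m2 => u t' < 0].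
    have e1 : nrm u = \sum_t sg R (s t) * u t.
      rewrite /nrm !(bigD1 (P := xpredT) t) //= !big1 ?addr0; last 2 first.
      - by move=> i; rewrite (all1 i) eqxx.
      - by move=> i; rewrite (all1 i) eqxx.
      rewrite sqrtr_sqr ffunE sgM.
      by case: ltrP => ut; [rewrite ltr0_norm|rewrite ger0_norm].
    have Hs : H s <= 2 * avg H.
      rewrite /avg card_ffun T N1 card_bool expn1 mulrC divfK //.
      by rewrite (bigD1 s) //= lerDl sumr_ge0.
    have h := hH s u; rewrite -e1 in h.
    rewrite N1 sqrtr1 mulr1 in avgH.
    have h2 : nrm u * rho <= 2 * C0 * nu u.
      rewrite -ler_pdivlMr //; apply: le_trans h _.
      rewrite [leRHS]mulrAC ler_wpM2r //; apply: le_trans Hs _.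
      by rewrite -[leRHS]mulrA ler_pM2l.
    have hc : c * (2 * C0 + 1) <= 1 by rewrite -ler_pdivlMr ?div1r //; lra.
    have nn := nu0 u.
    have h3 : c * (nrm u * rho) <= c * ((2 * C0 + 1) * nu u).
      by rewrite ler_wpM2l ?(ltW c0) //; lra.
    have h4 : c * (2 * C0 + 1) * nu u <= 1 * nu u by rewrite ler_wpM2r.
    by lra.
  exists (fun _ _ => 0); split => // x y.
  rewrite big1 ?mulr_ge0 ?nrm_ge0 // => j _.
  by rewrite big1 // => i _; rewrite mulr0 mul0r.
set N := (m1 + m2)%N in T avgH.
have N0 : (0 : R) < N%:R by rewrite ltr0n addn_gt0 m10.
set sN := Num.sqrt N%:R : R in avgH *.
have sN0 : 0 < sN by rewrite sqrtr_gt0.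
have sNN : sN ^+ 2 = N%:R by rewrite sqr_sqrtr // ltW.
pose B := (Num.truncn (R0 * sN)).+1.
have hB : R0 * sN <= B%:R.
  by have /andP[_ /ltW] := truncn_itv (mulr_ge0 (ltW R00) (ltW sN0)).
pose V := {ffun 'I_m1 + 'I_m2 -> 'I_(2 * B).+1}.
pose val (z : V) t : R := (z t)%:R - B%:R.
pose M s := 2 * rho * sN * H s.
pose P (z : V) := [forall s : {ffun 'I_m1 + 'I_m2 -> bool},
  \sum_t sg R (s t) * ((z t)%:R - B%:R) <= M s].
have cardP : #|P|%:R <= expR (kappa * N%:R) :> R.
  apply: le_trans (@card_integer_points R _ _ B%:R M P _) _.
    by move=> z /forallP.
  rewrite T /kappa mulrDl expRD; apply: ler_pM; rewrite ?exprn_ge0 ?expR_ge0 //.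
    rewrite expRM_natr; apply: lerXn2r; rewrite ?nnegrE ?expR_ge0 //.
    have -> : 2 = 1 + 1 :> R by [].
    by rewrite expRD; have := @expR_ge1Dx R 1; nra.
  rewrite ler_expR avgZ -sNN.
  apply: le_trans (ler_wpM2l _ avgH) _; first by rewrite !mulr_ge0 ?(ltW rho0) ?(ltW sN0).
  by rewrite le_eqVlt; apply/orP; left; apply/eqP; field; rewrite gt_eqF.
have [G [hG hE hF]] := hL m1 m2 V P (fun z j => val z (inl j))
  (fun z i => val z (inr i)) m10 m12 cardP.
(* A vector violating the estimate is close to a counted integer point. *)
have round_bad u : nu u < c * rho * nrm u -> exists z : V, exists d : 'I_m1 + 'I_m2 -> R,
    exists lam : R, [/\ P z, forall t, val z t = lam * u t + d t, nrm d <= sN &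
      (R0 - 1) * sN <= nrm (val z)].
  move=> hlt.
  have up : 0 < nrm u.
    rewrite lt_def nrm_ge0 andbT; apply/eqP => u0.
    by move: hlt; rewrite u0 mulr0 ltNge nu0.
  pose lam := R0 * sN / nrm u.
  have lam0 : 0 < lam by rewrite divr_gt0 ?mulr_gt0.
  pose x t := lam * u t.
  have xn : nrm x = R0 * sN by rewrite nrmZ gtr0_norm // divfK // gt_eqF.
  have xB t : `|x t| <= B%:R by apply: le_trans (nrm_coord _ _) _; rewrite xn.
  pose z : V := [ffun t => xchoose (round_box (xB t))].
  pose d t := val z t - x t.
  have dn : nrm d <= sN.
    apply: nrm_bounded => // t; rewrite distrC /val ffunE.
    exact: (xchooseP (round_box (xB t))).
  exists z, d, lam; split => //; last 2 first.
  - by move=> t; rewrite /d addrC subrK.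
  - have : nrm x <= nrm (val z) + nrm d.
      rewrite -[nrm d]nrmN; apply: le_trans (nrmD _ _).
      by rewrite le_eqVlt; apply/orP; left; apply/eqP/nrm_eq => t; rewrite /d; ring.
    by rewrite xn; lra.
  apply/forallP => s.
  have -> : \sum_t sg R (s t) * ((z t)%:R - B%:R) =
      lam * (\sum_t sg R (s t) * u t) + \sum_t sg R (s t) * d t.
    rewrite mulr_sumr -big_split /=; apply: eq_bigr => t _.
    by rewrite /d /val /x; ring.
  have h1 : lam * (\sum_t sg R (s t) * u t) <= lam * (H s * nu u).
    by rewrite ler_wpM2l ?(ltW lam0).
  have h2 : \sum_t sg R (s t) * d t <= H s * (rho * sN).
    apply: le_trans (hH _ _) _; rewrite ler_wpM2l //.
    by apply: le_trans (nurho _) _; rewrite ler_wpM2l // ltW.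
  have h3 : lam * nu u <= rho * sN.
    apply: (@le_trans _ _ (lam * (c * rho * nrm u))); first by rewrite ler_wpM2l ?ltW.
    have -> : lam * (c * rho * nrm u) = (c * R0) * (rho * sN).
      by rewrite /lam; field; rewrite gt_eqF.
    rewrite ler_piMl ?mulr_ge0 ?(ltW rho0) ?(ltW sN0) //.
    by rewrite -ler_pdivlMr // div1r.
  have h4 : H s * (lam * nu u) <= H s * (rho * sN) by rewrite ler_wpM2l.
  by rewrite /M; lra.
have row := nrm_row_le L0 hG.
have col := nrm_col_le L0 hG.
(* Numerical contradiction shared by the two subspaces. *)
have absurd (a b e : R) : 0 <= a -> a <= 20 * e -> b <= e + L * a ->
    e <= (1 + L) * sN -> (R0 - 1) * sN <= a + b -> False.
  move=> a0 ae be eL hab.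
  have L1 : 1 <= 1 + L by lra.
  have e1 : (1 + L) * a <= (1 + L) * (20 * ((1 + L) * sN)).
    by rewrite ler_wpM2l //; lra.
  have e2 : (1 + L) * sN <= (1 + L) ^+ 2 * sN.
    by rewrite ler_wpM2r ?(ltW sN0) // expr2 ler_peMl //; lra.
  have e3 : R0 * sN = 21 * ((1 + L) ^+ 2 * sN) + 2 * sN by rewrite /R0; ring.
  have e4 : (1 + L) * (20 * ((1 + L) * sN)) = 20 * ((1 + L) ^+ 2 * sN) by ring.
  by lra.
exists G; split => //.
- move=> u hu; rewrite leNgt; apply/negP => /round_bad[z [d [lam [Pz zE dn zn]]]].
  pose a j := val z (inl j); pose b i := val z (inr i).
  pose dl j := d (inl j); pose dr i := d (inr i).
  have aE : nrm a <= 20 * nrm (fun i => b i - \sum_j a j * G j i) by apply: hE.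
  apply: (absurd _ (nrm b) _ (nrm_ge0 a) aE).
  + rewrite (nrm_eq (v := fun i => (b i - \sum_j a j * G j i) + \sum_j a j * G j i)).
      by apply: le_trans (nrmD _ _) _; rewrite lerD2l row.
    by move=> i; rewrite subrK.
  + rewrite (nrm_eq (v := fun i => dr i + - \sum_j dl j * G j i)); last first.
      move=> i; rewrite /b zE hu.
      rewrite [X in _ - X](eq_bigr (fun j => lam * (u (inl j) * G j i) + dl j * G j i)).
        by rewrite big_split /= -mulr_sumr /dr; ring.
      by move=> j _; rewrite /a zE /dl; ring.
    apply: le_trans (nrmD _ _) _; rewrite nrmN mulrDl mul1r.
    apply: lerD; first exact: le_trans (nrm_inr_le d) dn.
    apply: le_trans (row _) _; rewrite ler_wpM2l //.
    exact: le_trans (nrm_inl_le d) dn.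
  + exact: le_trans zn (nrm_le_sum _).
- move=> u hu; rewrite leNgt; apply/negP => /round_bad[z [d [lam [Pz zE dn zn]]]].
  pose a j := val z (inl j); pose b i := val z (inr i).
  pose dl j := d (inl j); pose dr i := d (inr i).
  have bE : nrm b <= 20 * nrm (fun j => a j + \sum_i G j i * b i) by apply: hF.
  apply: (absurd _ (nrm a) _ (nrm_ge0 b) bE).
  + rewrite (nrm_eq (v := fun j => (a j + \sum_i G j i * b i) + - \sum_i G j i * b i)).
      by apply: le_trans (nrmD _ _) _; rewrite nrmN lerD2l col.
    by move=> i; rewrite addrK.
  + rewrite (nrm_eq (v := fun j => dl j + \sum_i G j i * dr i)); last first.
      move=> j; rewrite /a zE hu.
      rewrite [X in _ + X = _](eq_bigr (fun i => lam * (G j i * u (inr i)) + G j i * dr i)).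
        by rewrite big_split /= -mulr_sumr /dl; ring.
      by move=> i _; rewrite /b zE /dr; ring.
    apply: le_trans (nrmD _ _) _; rewrite mulrDl mul1r.
    apply: lerD; first exact: le_trans (nrm_inl_le d) dn.
    apply: le_trans (col _) _; rewrite ler_wpM2l //.
    exact: le_trans (nrm_inr_le d) dn.
  + by apply: le_trans zn _; rewrite addrC; apply: nrm_le_sum.
Qed.

End KashinCore.

(** * Projective norm and distance to Euclidean space *)

Section ProjectiveNorm.
Context {R : realType}.
Variables (n : nat) (p q r : \bar R).
Implicit Types A : tensor3 R n.

Lemma lpnorm_ge0 (s : \bar R) (x : 'rV[R]_n) : 0 <= lpnorm s x.
Proof.
case: s => [s| |] //=; first exact: powR_ge0.
by elim/big_ind: _ => // u v u0 v0; rewrite le_max u0.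
Qed.

Lemma elem_tensor_sum_basis A :
  A = \sum_(t : 'I_n * 'I_n * 'I_n)
        elem_tensor (A t *: delta_mx 0 t.1.1) (delta_mx 0 t.1.2) (delta_mx 0 t.2).
Proof.
apply/ffunP => t; rewrite sum_ffunE (bigD1 t) //= big1 ?addr0.
  by rewrite ffunE !mxE !eqxx !mulr1.
move=> -[[i j] k] ne; rewrite ffunE !mxE /=.
case: t ne => -[i' j'] k' /=; rewrite -!pair_eqE /= /pair_eq /= !xpair_eqE.
rewrite (eq_sym i') (eq_sym j') (eq_sym k').
by case: (i == i'); case: (j == j'); case: (k == k');
  rewrite ?(mulr1, mulr0, mul0r) //.
Qed.

Lemma projnorm_le_sum (I : finType) (x y z : I -> 'rV[R]_n) A :
  A = \sum_l elem_tensor (x l) (y l) (z l) ->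
  projnorm p q r A <= \sum_l lpnorm p (x l) * lpnorm q (y l) * lpnorm r (z l).
Proof.
move=> AE; rewrite /projnorm; apply: ge_inf.
  exists 0 => _ [m [x' [y' [z' [_ ->]]]]].
  by apply: sumr_ge0 => l _; rewrite !mulr_ge0 ?lpnorm_ge0.
have bij : bijective (@enum_val I predT) by apply: enum_val_bij.
exists #|I|, (x \o enum_val), (y \o enum_val), (z \o enum_val); split.
  by rewrite AE (reindex (@enum_val I predT)) //; apply: onW_bij.
by rewrite (reindex (@enum_val I predT)) //; apply: onW_bij.
Qed.

Lemma projnorm_ge A (c : R) :
  (forall m (x y z : 'I_m -> 'rV[R]_n), A = \sum_l elem_tensor (x l) (y l) (z l) ->
     c <= \sum_l lpnorm p (x l) * lpnorm q (y l) * lpnorm r (z l)) ->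
  c <= projnorm p q r A.
Proof.
move=> hc; rewrite /projnorm; apply: lb_le_inf.
  pose ev := @enum_val ('I_n * 'I_n * 'I_n)%type predT.
  eexists; exists #|{: 'I_n * 'I_n * 'I_n}|, (fun l => A (ev l) *: delta_mx 0 (ev l).1.1),
    (fun l => delta_mx 0 (ev l).1.2), (fun l => delta_mx 0 (ev l).2).
  split; last reflexivity.
  rewrite {1}(elem_tensor_sum_basis A) (reindex ev) //.
  by apply: onW_bij; apply: enum_val_bij.
by move=> _ [m [x [y [z [AE ->]]]]]; apply: hc.
Qed.

Lemma projnorm_ge0 A : 0 <= projnorm p q r A.
Proof.
apply: projnorm_ge => m x y z _.
by apply: sumr_ge0 => l _; rewrite !mulr_ge0 ?lpnorm_ge0.
Qed.

(** Duality: a tensor whose trilinear form is bounded by [h] gives a lower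
    bound on the projective norm. *)
Lemma projnorm_dual (S : 'I_n * 'I_n * 'I_n -> R) (h : R) A : 0 <= h ->
  (forall x y z : 'rV[R]_n,
     tri S (x 0) (y 0) (z 0) <= h * (lpnorm p x * lpnorm q y * lpnorm r z)) ->
  \sum_t S t * A t <= h * projnorm p q r A.
Proof.
move=> h0 hS.
have rep m (x y z : 'I_m -> 'rV[R]_n) : A = \sum_l elem_tensor (x l) (y l) (z l) ->
    \sum_t S t * A t <= h * \sum_l lpnorm p (x l) * lpnorm q (y l) * lpnorm r (z l).
  move=> AE; rewrite mulr_sumr.
  apply: le_trans (ler_sum _ (fun l _ => hS (x l) (y l) (z l))).
  rewrite /tri exchange_big /=; apply: ler_sum => t _.
  rewrite AE sum_ffunE mulr_sumr le_eqVlt; apply/orP; left; apply/eqP.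
  by apply: eq_bigr => l _; rewrite ffunE.
have [h1|h1] := eqVneq h 0; last first.
  have hp : 0 < h by rewrite lt_def h1.
  rewrite -ler_pdivrMl // ; apply: projnorm_ge => m x y z /rep.
  by rewrite ler_pdivrMl.
rewrite h1 mul0r.
pose ev := @enum_val ('I_n * 'I_n * 'I_n)%type predT.
have := rep _ (fun l => A (ev l) *: delta_mx 0 (ev l).1.1)
    (fun l => delta_mx 0 (ev l).1.2) (fun l => delta_mx 0 (ev l).2).
rewrite h1 mul0r; apply.
rewrite {1}(elem_tensor_sum_basis A) (reindex ev) //.
by apply: onW_bij; apply: enum_val_bij.
Qed.

End ProjectiveNorm.

Section EuclideanDistance.
Context {R : realType}.

Lemma lpnorm2E n (x : 'rV[R]_n) : lpnorm 2%:E x = nrm (x 0).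
Proof.
rewrite /lpnorm /nrm powR12_sqrt; last by apply: sumr_ge0 => i _; apply: powR_ge0.
by congr Num.sqrt; apply: eq_bigr => i _; rewrite powR_mulrn // real_normK ?num_real.
Qed.

Lemma linear_lfun (U V : vectType R) (f : U -> V) : linear f ->
  exists g : 'Hom(U, V), forall u, g u = f u.
Proof.
move=> lf.
pose fL : {linear U -> V} := HB.pack f (GRing.isLinear.Build R U V _ f lf).
by exists (linfun fL) => u; rewrite lfunE.
Qed.

(** The image of a linear map bounded above and below is a subspace close to a
    Euclidean space; the inverse map serves as the isomorphism. *)
Lemma dist_le n (p q r : \bar R) d (f : 'rV[R]_d -> tensor3 R n) (al be C : R) :
  linear f -> 0 < al -> 0 <= be -> be <= C * al -> 1 <= C ->
  (forall v : 'rV[R]_d, al * nrm (v 0) <= projnorm p q r (f v)) ->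
  (forall v : 'rV[R]_d, projnorm p q r (f v) <= be * nrm (v 0)) ->
  exists E : {vspace tensor3 R n},
    [/\ forall A, A \in E -> exists v, A = f v, \dim E = d &
        (dist_to_euclidean p q r E <= C%:E)%E].
Proof.
move=> lf al0 be0 beC C1 hal hbe.
have [g gf] := linear_lfun lf.
have inj : lker g == 0%VS.
  apply/lker0P => u v; rewrite !gf => uv.
  have f0 : f (u - v) = 0 by rewrite -gf linearB /= !gf uv subrr.
  have z0 : projnorm p q r (0 : tensor3 R n) <= 0.
    have := hbe 0; rewrite -gf linear0 => /le_trans; apply.
    by rewrite /nrm big1 ?sqrtr0 ?mulr0 // => i _; rewrite mxE expr0n.
  have n0 : nrm ((u - v) 0) = 0.
    apply/eqP; rewrite eq_le nrm_ge0 andbT -(ler_pM2l al0) mulr0.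
    by apply: le_trans (hal _) _; rewrite f0.
  apply/eqP; rewrite -subr_eq0; apply/eqP/rowP => i.
  by rewrite (nrm0_eq0 n0) mxE.
have dE : \dim (limg g) = d.
  by rewrite limg_dim_eq ?dimvf /dim /= ?mul1n //; move/eqP: inj => ->; rewrite capv0.
move: (limg g) dE (fun A => @memv_imgP _ _ _ g A fullv) => E dE memE.
have fE v : f v \in E.
  by rewrite -gf; apply/memE; exists v; rewrite ?memvf.
exists E; split => //.
  by move=> A /memE[v _ ->]; exists v; rewrite gf.
subst d.
rewrite /dist_to_euclidean /banach_mazur; case: ifP => _; first by rewrite lee_fin.
have [T TE] : exists T : 'Hom(subvs_of E, 'rV[R]_(\dim E)), forall u, T u = (g^-1)%VF (vsval u).
  by apply: linear_lfun => a u v; rewrite !linearP.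
have [T' T'E] : exists T' : 'Hom('rV[R]_(\dim E), subvs_of E), forall v, T' v = vsproj E (g v).
  by apply: linear_lfun => a u v; rewrite !linearP.
have TT' : cancel T' T.
  by move=> v; rewrite TE T'E vsprojK ?gf ?fE // -gf lker0_lfunK.
have T'T : cancel T T'.
  move=> u; rewrite TE T'E; apply: val_inj => /=.
  have /memE[v _ uv] := subvsP u.
  by rewrite uv lker0_lfunK // vsprojK // gf fE.
have bT : bijective T by exists T'.
have invT : T^-1%VF =1 T'.
  move=> v; rewrite -{1}(TT' v) lker0_lfunK //.
  by apply/lker0P; apply: can_inj T'T.
apply: ge_ereal_inf; eexists; first by exists T.
have op1 : (opnorm (fun u : subvs_of E => projnorm p q r (vsval u)) (lpnorm 2%:E) T
    <= (al^-1)%:E)%E.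
  apply: ge_ereal_sup => _ [u u1 <-]; rewrite lee_fin lpnorm2E.
  have {}u1 : projnorm p q r (vsval u) <= 1 by [].
  have := hal (T u); rewrite -gf => h.
  rewrite -[leRHS]mulr1 ler_pdivlMl //; apply: le_trans h _.
  apply: le_trans u1; rewrite TE.
  have /memE[v _ uv] := subvsP u.
  by rewrite uv lker0_lfunK.
have op2 : (opnorm (lpnorm 2%:E) (fun u : subvs_of E => projnorm p q r (vsval u)) T^-1%VF
    <= be%:E)%E.
  apply: ge_ereal_sup => _ [v v1 <-].
  have {}v1 : lpnorm 2%:E v <= 1 by [].
  rewrite lee_fin invT T'E vsprojK ?gf ?fE //.
  apply: le_trans (hbe v) _; rewrite -[leRHS]mulr1 ler_wpM2l //.
  by rewrite -lpnorm2E.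
have op20 : (0 <= opnorm (lpnorm 2%:E) (fun u : subvs_of E => projnorm p q r (vsval u)) T^-1%VF)%E.
  apply: (@le_trans _ _ (projnorm p q r (vsval (T^-1%VF 0)))%:E).
    by rewrite lee_fin projnorm_ge0.
  apply: ereal_sup_ubound; exists 0 => //.
  suff : lpnorm 2%:E (0 : 'rV[R]_(\dim E)) <= 1 by [].
  by rewrite lpnorm2E /nrm big1 ?sqrtr0 ?ler01 // => i _; rewrite mxE expr0n.
apply: (@le_trans _ _ ((al^-1)%:E * be%:E)%E).
  apply: (@le_trans _ _ ((al^-1)%:E * opnorm (lpnorm 2%:E)
    (fun u : subvs_of E => projnorm p q r (vsval u)) T^-1%VF)%E).
    by rewrite lee_wpmul2r.
  by rewrite lee_wpmul2l // lee_fin invr_ge0 ltW.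
by rewrite -EFinM lee_fin mulrC ler_pdivrMr.
Qed.

End EuclideanDistance.

(** * Decomposition of the space of tensors *)

Section KashinTensor.
Context {R : realType}.

Lemma exists_bij (T T' : finType) : #|T| = #|T'| -> exists e : T -> T', bijective e.
Proof.
move=> h; exists (fun t => enum_val (cast_ord h (enum_rank t))).
apply: bij_comp; first exact: enum_val_bij.
apply: bij_comp; last exact: enum_rank_bij.
by exists (cast_ord (esym h)); [apply: cast_ordK|apply: cast_ordKV].
Qed.

(** Transfer of the abstract decomposition to tensors: the index set is split
    in two halves, the two subspaces being the graph of a matrix over the first
    half and its orthogonal complement. *)
Lemma kashin_tensor (p q r : \bar R) (C0 : R) : 0 <= C0 ->
  exists C : R, 1 <= C /\ forall (n : nat) (rho : R)
    (H : {ffun 'I_n * 'I_n * 'I_n -> bool} -> R), 0 < rho ->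
  (forall A : tensor3 R n, projnorm p q r A <= rho * nrm A) ->
  (forall s, 0 <= H s) ->
  (forall (s : {ffun 'I_n * 'I_n * 'I_n -> bool}) (x y z : 'rV[R]_n),
     tri (fun t => sg R (s t)) (x 0) (y 0) (z 0) <=
       H s * (lpnorm p x * lpnorm q y * lpnorm r z)) ->
  avg H <= C0 * Num.sqrt (n ^ 3)%:R / rho ->
  exists E F : {vspace tensor3 R n},
    [/\ forall A B : tensor3 R n, A \in E -> B \in F -> tensor_dot A B = 0,
        \dim E = ((n ^ 3)./2)%N, \dim F = uphalf (n ^ 3),
        (dist_to_euclidean p q r E <= C%:E)%E &
        (dist_to_euclidean p q r F <= C%:E)%E].
Proof.
move=> C00; have [L [c [L0 c0 core]]] := kashin_core C00.
exists (Num.max 1 ((1 + L) / c)); split; first by rewrite le_max lexx.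
move=> n rho H rho0 hrho H0 hH avgH.
pose m1 := ((n ^ 3)./2)%N; pose m2 := uphalf (n ^ 3).
have m12 : (m1 + m2)%N = (n ^ 3)%N by rewrite /m2 uphalf_half addnCA addnn odd_double_half.
have m12' : (m1 <= m2 <= m1.+1)%N.
  by rewrite /m1 /m2 uphalf_half; case: (odd _); rewrite ?leqnn ?leqnSn.
have cT : #|{: 'I_n * 'I_n * 'I_n}| = #|{: 'I_m1 + 'I_m2}|.
  by rewrite card_sum !card_prod !card_ord m12 !expnS expn0 muln1 mulnA.
have [e be] := exists_bij cT.
have [e' ee' e'e] := be.
pose tens (u : 'I_m1 + 'I_m2 -> R) : tensor3 R n := [ffun t => u (e t)].
have tens_nrm u : nrm (tens u) = nrm u.
  rewrite /nrm [in RHS](reindex e) /=; last exact: onW_bij.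
  by congr Num.sqrt; apply: eq_bigr => t _; rewrite ffunE.
pose nu u := projnorm p q r (tens u).
pose H' (s : {ffun 'I_m1 + 'I_m2 -> bool}) := H [ffun t => s (e t)].
have hnu u : nu u <= rho * nrm u by rewrite -tens_nrm; apply: hrho.
have hH' (s : {ffun 'I_m1 + 'I_m2 -> bool}) u : \sum_t sg R (s t) * u t <= H' s * nu u.
  rewrite (reindex e) /=; last exact: onW_bij.
  have := projnorm_dual (tens u) (H0 _) (hH [ffun t => s (e t)]).
  by apply: le_trans; apply: ler_sum => t _; rewrite !ffunE.
have avgH' : avg H' <= C0 * Num.sqrt (m1 + m2)%:R / rho.
  by rewrite (avg_bij H (ffun_comp_bij bool be)) m12.
have [G [hG hE hF]] := core m1 m2 nu rho H' m12' rho0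
  (fun u => projnorm_ge0 _ _ _ _) hnu (fun s => H0 _) hH' avgH'.
pose uE (a : 'rV[R]_m1) (t : 'I_m1 + 'I_m2) : R :=
  match t with inl j => a 0 j | inr i => \sum_j a 0 j * G j i end.
pose uF (b : 'rV[R]_m2) (t : 'I_m1 + 'I_m2) : R :=
  match t with inl j => - \sum_i G j i * b 0 i | inr i => b 0 i end.
have al0 : 0 < c * rho by rewrite mulr_gt0.
have be0 : 0 <= rho * (1 + L) by rewrite mulr_ge0 ?addr_ge0 ?(ltW rho0).
have C1 : 1 <= Num.max 1 ((1 + L) / c) :> R by rewrite le_max lexx.
have bC : rho * (1 + L) <= Num.max 1 ((1 + L) / c) * (c * rho).
  have -> : rho * (1 + L) = ((1 + L) / c) * (c * rho) by field; rewrite gt_eqF.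
  by rewrite ler_wpM2r ?(ltW al0) // le_max lexx orbT.
have linE : linear (fun a => tens (uE a)).
  move=> k a b; apply/ffunP => t; rewrite !ffunE /=.
  case: (e t) => [j|i] /=; first by rewrite !mxE.
  rewrite scaler_sumr -big_split /=; apply: eq_bigr => j _.
  by rewrite !mxE mulrDl -mulrA.
have linF : linear (fun b => tens (uF b)).
  move=> k a b; apply/ffunP => t; rewrite !ffunE /=.
  case: (e t) => [j|i] /=; last by rewrite !mxE.
  rewrite scalerN -opprD scaler_sumr -big_split /=; congr (- _).
  apply: eq_bigr => i _; rewrite !mxE mulrDr; congr (_ + _).
  by rewrite mulrCA.
have lowE (a : 'rV[R]_m1) : c * rho * nrm (a 0) <= projnorm p q r (tens (uE a)).
  apply: le_trans (hE (uE a) (fun=> erefl)).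
  by rewrite ler_wpM2l ?(ltW al0) //; apply: (nrm_inl_le (uE a)).
have uppE (a : 'rV[R]_m1) : projnorm p q r (tens (uE a)) <= rho * (1 + L) * nrm (a 0).
  apply: le_trans (hnu _) _; rewrite -mulrA ler_wpM2l ?(ltW rho0) //.
  apply: le_trans (nrm_le_sum _) _; rewrite mulrDl mul1r lerD //.
  exact: (nrm_row_le L0 hG).
have lowF (b : 'rV[R]_m2) : c * rho * nrm (b 0) <= projnorm p q r (tens (uF b)).
  apply: le_trans (hF (uF b) (fun=> erefl)).
  by rewrite ler_wpM2l ?(ltW al0) //; apply: (nrm_inr_le (uF b)).
have uppF (b : 'rV[R]_m2) : projnorm p q r (tens (uF b)) <= rho * (1 + L) * nrm (b 0).
  apply: le_trans (hnu _) _; rewrite -mulrA ler_wpM2l ?(ltW rho0) //.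
  apply: le_trans (nrm_le_sum _) _; rewrite mulrDl mul1r addrC lerD //.
  by rewrite nrmN; apply: (nrm_col_le L0 hG).
have [E [memE dimE distE]] := dist_le linE al0 be0 bC C1 lowE uppE.
have [F [memF dimF distF]] := dist_le linF al0 be0 bC C1 lowF uppF.
exists E, F; split => // A B /memE[a ->] /memF[b ->].
rewrite /tensor_dot.
transitivity (\sum_t uE a t * uF b t).
  rewrite [RHS](reindex e) /=; last exact: onW_bij.
  by apply: eq_bigr => t _; rewrite !ffunE.
rewrite big_sumType /=.
rewrite [X in _ + X](_ : _ = \sum_j \sum_i a 0 j * (G j i * b 0 i)).
  rewrite -big_split /= big1 // => j _.
  by rewrite mulrN mulr_sumr addNr.
rewrite exchange_big; apply: eq_bigr => i _; rewrite mulr_suml.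
by apply: eq_bigr => j _; rewrite mulrA.
Qed.

End KashinTensor.

(** * Comparison of the norms of l_p *)

(** The norm of $\ell_s^n$ for finite [s], on functions. *)
Definition lpn (R : realType) (n : nat) (s : R) (x : 'I_n -> R) : R :=
  (\sum_i `|x i| `^ s) `^ s^-1.

Section LpNorms.
Context {R : realType}.
Variable n : nat.
Implicit Types x : 'I_n -> R.

Lemma lpn_ge0 s x : 0 <= lpn s x.
Proof. exact: powR_ge0. Qed.

Lemma sum_powR_ge0 s x : 0 <= \sum_i `|x i| `^ s.
Proof. by apply: sumr_ge0 => i _; apply: powR_ge0. Qed.

Lemma lpn_powR s x : 0 < s -> lpn s x `^ s = \sum_i `|x i| `^ s.
Proof.
by move=> s0; rewrite -powRrM mulVf ?gt_eqF // powRr1 // sum_powR_ge0.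
Qed.

Lemma eq_lpn s x (y : 'I_n -> R) : x =1 y -> lpn s x = lpn s y.
Proof. by move=> xy; congr (_ `^ _); apply: eq_bigr => i _; rewrite xy. Qed.

Lemma lpnZ s (c : R) x : 0 < s -> lpn s (fun i => c * x i) = `|c| * lpn s x.
Proof.
move=> s0; rewrite /lpn; under eq_bigr do rewrite normrM powRM //.
rewrite -mulr_sumr powRM ?powR_ge0 ?sum_powR_ge0 //.
by rewrite -powRrM mulfV ?gt_eqF // powRr1.
Qed.

Lemma lpn_le s x c : 0 < s -> 0 <= c -> \sum_i `|x i| `^ s <= c `^ s -> lpn s x <= c.
Proof.
move=> s0 c0 h.
have -> : c = (c `^ s) `^ s^-1 by rewrite -powRrM mulfV ?gt_eqF // powRr1.
by apply: ge0_ler_powR; rewrite ?nnegrE ?invr_ge0 ?powR_ge0 ?sum_powR_ge0 // ltW.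
Qed.

Lemma lpn_eq0 s x : 0 < s -> lpn s x = 0 -> forall i, x i = 0.
Proof.
move=> s0 x0 i; have := lpn_powR x s0; rewrite x0 powR0 ?gt_eqF // => /esym h.
have /eqP : `|x i| `^ s = 0.
  by apply: (psumr_eq0P _ h) => // j _; apply: powR_ge0.
by rewrite powR_eq0 => /andP[/eqP/normr0_eq0].
Qed.

Lemma lpn_zero s x : 0 < s -> (forall i, x i = 0) -> lpn s x = 0.
Proof.
move=> s0 x0; rewrite (@eq_lpn _ x (fun i => 0 * x i)); last by move=> i; rewrite mul0r.
by rewrite lpnZ // normr0 mul0r.
Qed.

Lemma lpn_normalize s x : 0 < s -> 0 < lpn s x ->
  \sum_i `|(lpn s x)^-1 * x i| `^ s = 1.
Proof.
move=> s0 x0; rewrite -(lpn_powR (fun i => (lpn s x)^-1 * x i)) // lpnZ //.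
by rewrite ger0_norm ?invr_ge0 ?lpn_ge0 // mulVf ?gt_eqF // powR1.
Qed.

Lemma lpn2E x : lpn 2 x = nrm x.
Proof.
rewrite /lpn /nrm powR12_sqrt ?sum_powR_ge0 //.
by congr Num.sqrt; apply: eq_bigr => i _; rewrite powR_mulrn // real_normK ?num_real.
Qed.

Lemma le_lpn s t x : 0 < s -> s <= t -> lpn t x <= lpn s x.
Proof.
move=> s0 st; have t0 : 0 < t by apply: lt_le_trans st.
have [x0|x0] := eqVneq (lpn s x) 0.
  by rewrite (lpn_zero t0) ?lpn_ge0 //; apply: lpn_eq0 x0.
have xp : 0 < lpn s x by rewrite lt_def x0 lpn_ge0.
rewrite (@eq_lpn _ x (fun i => lpn s x * ((lpn s x)^-1 * x i))); last first.
  by move=> i; rewrite mulVKf.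
rewrite lpnZ // gtr0_norm // -[leRHS]mulr1 ler_pM2l //.
have h1 := lpn_normalize s0 xp.
apply: lpn_le => //; rewrite powR1 -h1; apply: ler_sum => i _.
set y := (lpn s x)^-1 * x i.
have y1 : `|y| `^ s <= 1.
  by rewrite -h1 (bigD1 i) //= lerDl; apply: sumr_ge0 => j _; apply: powR_ge0.
have [->|y0] := eqVneq y 0; first by rewrite normr0 !powR0 ?gt_eqF.
apply: ger_powR => //; rewrite normr_gt0 y0 /=.
rewrite leNgt; apply/negP => y2; move: y1; rewrite leNgt => /negP; apply.
apply: (@le_lt_trans _ _ (1 `^ s)); first by rewrite powR1.
by rewrite gt0_ltr_powR ?nnegrE.
Qed.

Lemma bernoulli_powR (v al : R) : 0 <= v -> 0 < al -> al <= 1 ->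
  v `^ al <= 1 - al + al * v.
Proof.
move=> v0 al0 al1; have [->|vn0] := eqVneq v 0.
  by rewrite powR0 ?gt_eqF // mulr0 addr0 subr_ge0.
have vp : 0 < v by rewrite lt_def vn0.
rewrite /powR (negPf vn0); set l := ln v.
have vE : v = expR l by rewrite lnK.
have E0 := expR_gt0 (al * l).
have h1 : expR (al * l) * (1 + (1 - al) * l) <= v.
  have -> : v = expR (al * l) * expR ((1 - al) * l).
    by rewrite -expRD [LHS]vE; congr expR; ring.
  by rewrite ler_pM2l // expR_ge1Dx.
have h2 : expR (al * l) * (1 - al * l) <= 1.
  rewrite -[leRHS](expRxMexpNx_1 (al * l)) ler_pM2l //.
  by have := @expR_ge1Dx R (- (al * l)).
have h3 : al * (expR (al * l) * (1 + (1 - al) * l)) <= al * v by rewrite ler_pM2l.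
have h4 : (1 - al) * (expR (al * l) * (1 - al * l)) <= (1 - al) * 1.
  by rewrite ler_wpM2l // subr_ge0.
by move: h3 h4; set E := expR _; lra.
Qed.

Lemma power_mean s t x : (0 < n)%N -> 0 < s -> s <= t ->
  lpn s x <= n%:R `^ s^-1 / n%:R `^ t^-1 * lpn t x.
Proof.
move=> n0 s0 st; have t0 : 0 < t by apply: lt_le_trans st.
have N0 : (0 : R) < n%:R by rewrite ltr0n.
have [x0|x0] := eqVneq (lpn t x) 0.
  by rewrite (lpn_zero s0) ?x0 ?mulr0 //; apply: lpn_eq0 x0.
have xp : 0 < lpn t x by rewrite lt_def x0 lpn_ge0.
have nt : 0 < (n%:R : R) `^ t^-1 by apply: powR_gt0.
pose M := lpn t x / n%:R `^ t^-1.
have M0 : 0 < M by apply: divr_gt0.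
pose y i := M^-1 * x i.
rewrite (@eq_lpn _ x (fun i => M * y i)); last first.
  by move=> i; rewrite /y mulVKf // gt_eqF.
have yM : lpn s (fun i => M * y i) = M * lpn s y by rewrite (lpnZ M y s0) gtr0_norm.
rewrite [leLHS]yM.
have -> : n%:R `^ s^-1 / n%:R `^ t^-1 * lpn t x = M * n%:R `^ s^-1.
  by rewrite /M; ring.
rewrite ler_pM2l //; apply: lpn_le; rewrite ?powR_ge0 //.
rewrite -powRrM mulVf ?gt_eqF // powRr1 //.
have sy : \sum_i `|y i| `^ t = n%:R.
  rewrite -lpn_powR // (lpnZ M^-1 x t0) gtr0_norm ?invr_gt0 // /M invfM invrK mulrAC mulVf //.
  by rewrite mul1r -powRrM mulVf ?gt_eqF // powRr1.
apply: (@le_trans _ _ (\sum_i (1 - s / t + s / t * `|y i| `^ t))).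
  apply: ler_sum => i _.
  have -> : `|y i| `^ s = (`|y i| `^ t) `^ (s / t).
    by rewrite -powRrM mulrC divfK // gt_eqF.
  apply: bernoulli_powR; rewrite ?powR_ge0 ?divr_gt0 //.
  by rewrite ler_pdivrMr // mul1r.
rewrite big_split /= -mulr_sumr sy sumr_const card_ord -mulr_natr.
by rewrite le_eqVlt; apply/orP; left; apply/eqP; ring.
Qed.

Lemma lpn_delta s (i : 'I_n) : 0 < s -> lpn s ((delta_mx 0 i : 'rV[R]_n) 0) <= 1.
Proof.
move=> s0; apply: lpn_le => //; rewrite powR1 (bigD1 i) //= big1 => [|j ji].
  by rewrite mxE !eqxx normr1 powR1 addr0.
by rewrite mxE (negPf ji) andbF normr0 powR0 // gt_eqF.
Qed.

Lemma lpn_sign s (e : 'I_n -> bool) : 0 < s ->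
  lpn s (fun i => sg R (e i)) = n%:R `^ s^-1.
Proof.
move=> s0; rewrite /lpn (eq_bigr (fun=> 1)) ?sumr_const ?card_ord //.
by move=> i _; rewrite /sg normrX normrN1 expr1n powR1.
Qed.

End LpNorms.

Section InterpolationLp.
Context {R : realType}.

Lemma triZ n S (a b c : R) (x y z : 'I_n -> R) :
  tri S (fun i => a * x i) (fun i => b * y i) (fun i => c * z i) =
  a * b * c * tri S x y z.
Proof. by rewrite /tri mulr_sumr; apply: eq_bigr => t _; ring. Qed.

(** Interpolation of a trilinear form bounded on [l_1] and [l_2]. *)
Lemma interpolation (r : R) : 1 <= r <= 2 ->
  exists C : R, 0 <= C /\ forall n (S : 'I_n * 'I_n * 'I_n -> R) (L : R),
   (forall t, `|S t| <= 1) -> 1 <= L ->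
   (forall x y z, tri S x y z <= L * nrm x * nrm y * nrm z) ->
   forall x y z : 'I_n -> R,
     tri S x y z <= C * L `^ (2 * (1 - r^-1)) * (lpn r x * lpn r y * lpn r z).
Proof.
move=> /andP[r1 r2].
have [->|rn1] := eqVneq r 1.
  exists 1; split => // n S L hS _ _ x y z.
  rewrite invr1 subrr mulr0 powRr0 mulr1 mul1r.
  apply: le_trans (tri_le _ _ _ hS) _.
  have e (u : 'I_n -> R) : lpn 1 u = \sum_i `|u i|.
    rewrite /lpn invr1 powRr1 ?sum_powR_ge0 //.
    by apply: eq_bigr => i _; rewrite powRr1.
  by rewrite !e.
have [->|rn2] := eqVneq r 2.
  exists 1; split => // n S L hS L1 hL x y z.
  have -> : 2 * (1 - 2^-1) = 1 :> R by field.
  rewrite powRr1 ?mul1r; last by lra.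
  by rewrite !lpn2E !mulrA.
have rr : 1 < r < 2 by rewrite !lt_neqAle r1 r2 eq_sym rn1 rn2.
have r0 : 0 < r by lra.
have [C [C0 hC]] := interpolation_normalized rr.
exists C; split => // n S L hS L1 hL x y z.
have K0 : 0 <= C * L `^ (2 * (1 - r^-1)) by rewrite mulr_ge0 ?powR_ge0.
have zero (u v w : 'I_n -> R) : (forall i, u i = 0) \/ (forall i, v i = 0) \/
    (forall i, w i = 0) -> tri S u v w = 0.
  by move=> h; rewrite /tri big1 // => t _; case: h => [->|[->|->]];
    rewrite ?(mulr0, mul0r).
have rhs0 : 0 <= C * L `^ (2 * (1 - r^-1)) * (lpn r x * lpn r y * lpn r z).
  by rewrite !mulr_ge0 ?lpn_ge0 ?powR_ge0.
have [x0|x0] := eqVneq (lpn r x) 0.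
  by rewrite zero //; left; apply: lpn_eq0 x0.
have [y0|y0] := eqVneq (lpn r y) 0.
  by rewrite zero //; right; left; apply: lpn_eq0 y0.
have [z0|z0] := eqVneq (lpn r z) 0.
  by rewrite zero //; right; right; apply: lpn_eq0 z0.
have pos (u : 'I_n -> R) : lpn r u != 0 -> 0 < lpn r u by rewrite lt_def lpn_ge0 => ->.
have := hC n S L hS L1 hL (fun i => (lpn r x)^-1 * x i) (fun i => (lpn r y)^-1 * y i)
  (fun i => (lpn r z)^-1 * z i).
rewrite !lpn_normalize ?pos // triZ => /(_ (lexx _) (lexx _) (lexx _)).
rewrite -!invfM ler_pdivrMl; last by rewrite !mulr_gt0 ?pos.
have swap (t u v : R) : t <= u * v -> t <= v * u by rewrite mulrC.
exact: swap.
Qed.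

End InterpolationLp.

(** * Upper bounds for projective norms *)

Section UpperBounds.
Context {R : realType}.

Lemma lpnormE n (s : R) (x : 'rV[R]_n) : lpnorm s%:E x = lpn s (x 0).
Proof. by []. Qed.

Lemma lpnorm_delta n (s : \bar R) (i : 'I_n) : (1 <= s)%E ->
  lpnorm s (delta_mx 0 i : 'rV[R]_n) <= 1.
Proof.
case: s => [s| |] //=; first by rewrite lee_fin => s1; apply: lpn_delta; lra.
move=> _; apply: bigmax_le => // j _.
by rewrite mxE; case: (_ && _); rewrite ?normr1 ?normr0.
Qed.

Lemma sum_nrm_le (T : finType) (f : T -> R) :
  \sum_t f t <= Num.sqrt #|T|%:R * nrm f.
Proof.
have := cauchy_schwarz (fun=> 1) f.
rewrite {1}/nrm; under eq_bigr do rewrite mul1r.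
by under [X in Num.sqrt X]eq_bigr do rewrite expr1n; rewrite sumr_const.
Qed.

Lemma nrm_ij n (A : 'I_n * 'I_n * 'I_n -> R) :
  nrm (fun ij : 'I_n * 'I_n => nrm (fun k => A (ij, k))) = nrm A.
Proof.
congr Num.sqrt; under eq_bigr do rewrite nrm_sqr.
by rewrite pair_bigA /=; apply: eq_bigr => -[[i j] k] _.
Qed.

Lemma nrm_i n (A : 'I_n * 'I_n * 'I_n -> R) :
  nrm (fun i => nrm (fun jk : 'I_n * 'I_n => A (i, jk.1, jk.2))) = nrm A.
Proof.
congr Num.sqrt; under eq_bigr do rewrite nrm_sqr.
rewrite sum_triple; apply: eq_bigr => i _.
by rewrite pair_bigA /=; apply: eq_bigr => -[].
Qed.

(** Splitting a tensor into its $n^2$ fibres in the last direction. *)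
Lemma projnorm_le_fibres n (p q : \bar R) (r : R) (A : tensor3 R n) :
  (0 < n)%N -> (1 <= p)%E -> (1 <= q)%E -> 1 <= r -> r <= 2 ->
  projnorm p q r%:E A <= n%:R `^ r^-1 * Num.sqrt n%:R * nrm A.
Proof.
move=> n0 p1 q1 r1 r2.
pose z (ij : 'I_n * 'I_n) : 'rV[R]_n := \row_k A (ij, k).
have zE ij : lpnorm r%:E (z ij) <= n%:R `^ r^-1 / Num.sqrt n%:R * nrm (fun k => A (ij, k)).
  have r0 : 0 < r by lra.
  have := power_mean ((z ij) 0) n0 r0 r2.
  rewrite lpn2E powR12_sqrt // lpnormE; congr (_ <= _ * _).
  by apply: nrm_eq => k; rewrite mxE.
apply: le_trans (@projnorm_le_sum R n p q r%:E _ (fun ij => delta_mx 0 ij.1)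
  (fun ij => delta_mx 0 ij.2) z A _) _.
  apply/ffunP => -[[i j] k]; rewrite sum_ffunE (bigD1 (i, j)) //= big1 ?addr0.
    by rewrite ffunE !mxE !eqxx !mul1r.
  move=> -[i' j'] ne; rewrite ffunE !mxE /= (eq_sym i) (eq_sym j).
  move: ne; rewrite xpair_eqE; case: (i' == i) => /=; last by rewrite !mul0r.
  by move=> /negPf->; rewrite mulr0 mul0r.
apply: (@le_trans _ _ (\sum_ij n%:R `^ r^-1 / Num.sqrt n%:R * nrm (fun k => A (ij, k)))).
  apply: ler_sum => ij _; apply: le_trans (zE ij).
  rewrite -[leRHS]mul1r ler_wpM2r ?lpnorm_ge0 //.
  by rewrite mulr_ile1 ?lpnorm_ge0 ?lpnorm_delta.
rewrite -mulr_sumr.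
have s0 : 0 < Num.sqrt n%:R :> R by rewrite sqrtr_gt0 ltr0n.
have h := sum_nrm_le (fun ij : 'I_n * 'I_n => nrm (fun k => A (ij, k))).
rewrite nrm_ij card_prod card_ord natrM -expr2 sqrtr_sqr ger0_norm // in h.
apply: le_trans (ler_wpM2l _ h) _; first by rewrite divr_ge0 ?powR_ge0 ?(ltW s0).
have nE : n%:R = Num.sqrt n%:R ^+ 2 :> R by rewrite sqr_sqrtr.
move: nE s0; set t := n%:R `^ r^-1; set w := Num.sqrt n%:R => -> s0.
by rewrite le_eqVlt; apply/orP; left; apply/eqP; field; rewrite gt_eqF.
Qed.

Lemma avg_sign_mul n (k k' : 'I_n) :
  avg (fun s : {ffun 'I_n -> bool} => sg R (s k') * sg R (s k)) = (k' == k)%:R.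
Proof.
have c0 : (0 < #|{: {ffun 'I_n -> bool}}|)%N by rewrite card_ffun expn_gt0 card_bool.
have [->|kk] := eqVneq k' k.
  rewrite (avg_eq (g := fun=> 1)) ?avg_cst // => s.
  by rewrite sgM /sg; case: (s k); rewrite ?expr1 ?opprK ?expr0.
(* Flipping the sign of the k-th coordinate. *)
pose h (s : {ffun 'I_n -> bool}) := [ffun i => if i == k then ~~ s i else s i].
have hh : involutive h.
  by move=> s; apply/ffunP => i; rewrite !ffunE; case: eqP; rewrite ?negbK.
set F := fun s : {ffun 'I_n -> bool} => _.
have := avg_bij F (inv_bij hh).
rewrite (avg_eq (g := fun s => -1 * F s)) ?avgZ.
  by move/eqP; rewrite mulN1r eq_sym -addr_eq0 -mulr2n mulrn_eq0 /= => /eqP.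
move=> s; rewrite /F !ffunE (negPf kk) eqxx /sg.
by case: (s k) => /=; rewrite ?expr1 ?expr0 !mulN1r ?mulrN ?opprK.
Qed.

(** Splitting a tensor into the [n] matrices $A_i$, each of which is the mean
    over the sign vectors $\epsilon$ of $(A_i \epsilon) \otimes \epsilon$. *)
Lemma projnorm_le_signs n (p r : \bar R) (tau : R) (A : tensor3 R n) :
  (0 < n)%N -> (1 <= p)%E -> 0 <= tau ->
  (forall s : {ffun 'I_n -> bool}, lpnorm r (\row_k sg R (s k)) <= tau) ->
  projnorm p 2%:E r A <= tau * Num.sqrt n%:R * nrm A.
Proof.
move=> n0 p1 tau0 htau.
pose X := {ffun 'I_n -> bool}.
have c0 : (0 < #|{: X}|)%N by rewrite card_ffun expn_gt0 card_bool.
have X0 : (0 : R) < #|{: X}|%:R by rewrite ltr0n.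
pose v (i : 'I_n) (s : X) (j : 'I_n) : R := \sum_k sg R (s k) * A (i, j, k).
apply: le_trans (@projnorm_le_sum R n p 2%:E r ('I_n * X)%type
  (fun u => delta_mx 0 u.1) (fun u => \row_j (#|{: X}|%:R^-1 * v u.1 u.2 j))
  (fun u => \row_k sg R (u.2 k)) A _) _.
  apply/ffunP => -[[i j] k]; rewrite sum_ffunE.
  rewrite -(pair_bigA _ (fun i' s => elem_tensor (delta_mx 0 i' : 'rV[R]_n)
    (\row_j0 (#|{: X}|%:R^-1 * v i' s j0)) (\row_k0 sg R (s k0)) (i, j, k))) /=.
  rewrite (bigD1 i) //= [X in _ = _ + X]big1 ?addr0; last first.
    move=> i' ne; rewrite big1 // => s _; rewrite ffunE !mxE /=.
    by rewrite (eq_sym i) (negPf ne) /= !mul0r.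
  transitivity (\sum_k' A (i, j, k') * avg (fun s : X => sg R (s k') * sg R (s k))).
    rewrite (bigD1 k) //= avg_sign_mul eqxx mulr1 big1 ?addr0 // => k' ne.
    by rewrite avg_sign_mul (negPf ne) mulr0.
  under [LHS]eq_bigr do rewrite -avgZ.
  rewrite -avg_sum /avg mulr_suml; apply: eq_bigr => s _.
  rewrite ffunE !mxE !eqxx /= mul1r /v mulrC mulr_sumr mulr_sumr mulr_suml.
  by apply: eq_bigr => k' _; ring.
rewrite -(pair_bigA _ (fun i s => lpnorm p (delta_mx 0 i : 'rV[R]_n) *
    lpnorm 2%:E (\row_j (#|{: X}|%:R^-1 * v i s j)) * lpnorm r (\row_k sg R (s k)))).
apply: (@le_trans _ _ (\sum_i tau * avg (fun s : X => nrm (v i s)))).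
  apply: ler_sum => i _; rewrite -avgZ /avg mulr_suml; apply: ler_sum => s _.
  have -> : lpnorm 2%:E (\row_j (#|{: X}|%:R^-1 * v i s j)) = #|{: X}|%:R^-1 * nrm (v i s).
    rewrite lpnorm2E (nrm_eq (v := fun j => #|{: X}|%:R^-1 * v i s j)).
      by rewrite nrmZ ger0_norm // invr_ge0 ltW.
    by move=> j; rewrite mxE.
  have nv : 0 <= #|{: X}|%:R^-1 * nrm (v i s) by rewrite mulr_ge0 ?invr_ge0 ?nrm_ge0.
  apply: (@le_trans _ _ (1 * (#|{: X}|%:R^-1 * nrm (v i s)) * tau)); last first.
    by rewrite le_eqVlt; apply/orP; left; apply/eqP; ring.
  apply: ler_pM; rewrite ?mulr_ge0 ?lpnorm_ge0 ?invr_ge0 ?nrm_ge0 //.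
  by rewrite ler_wpM2r // lpnorm_delta.
have mean i : avg (fun s : X => nrm (v i s)) <=
    nrm (fun jk : 'I_n * 'I_n => A (i, jk.1, jk.2)).
  set a := nrm (fun jk : 'I_n * 'I_n => _).
  have sqa : avg (fun s : X => nrm (v i s) ^+ 2) = a ^+ 2.
    rewrite (avg_eq (g := fun s : X => \sum_j v i s j ^+ 2)); last by move=> s; rewrite nrm_sqr.
    rewrite avg_sum /a nrm_sqr.
    rewrite -(pair_bigA _ (fun j k => A (i, j, k) ^+ 2)) /=; apply: eq_bigr => j _.
    exact: avg_sign_sqr.
  (* Jensen's inequality for the square. *)
  rewrite -ler_sqr ?nnegrE ?nrm_ge0 ?avg_ge0 // => [|s]; last exact: nrm_ge0.
  rewrite -sqa; set m := avg _.
  suff : 0 <= avg (fun s : X => nrm (v i s) ^+ 2 + ((- (2 * m)) * nrm (v i s) + m ^+ 2)).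
    by rewrite !avgD avgZ avg_cst // -/m; lra.
  apply: avg_ge0 => s; have := sqr_ge0 (nrm (v i s) - m).
  by rewrite sqrrB -mulr_natr; lra.
rewrite -mulr_sumr -mulrA ler_wpM2l //.
apply: le_trans (ler_sum _ (fun i _ => mean i)) _.
apply: le_trans (sum_nrm_le _) _.
by rewrite card_ord (nrm_i A).
Qed.

End UpperBounds.

(** * Random dual tensors *)

Section DualTensors.
Context {R : realType}.

Lemma sqrt_cube n : Num.sqrt (n ^ 3)%:R = n%:R * Num.sqrt n%:R :> R.
Proof.
rewrite expnSr natrM sqrtrM // expnS expn1 natrM -expr2 sqrtr_sqr.
by rewrite ger0_norm.
Qed.

Lemma powR_le_linear (x a th : R) : 0 < a -> 0 <= x -> 0 <= th -> th <= 1 ->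
  x `^ th <= a `^ th * (1 + x / a).
Proof.
move=> a0 x0 th0 th1.
have y0 : 0 <= x / a by rewrite divr_ge0 // ltW.
have -> : x = a * (x / a) by field; rewrite gt_eqF.
rewrite powRM ?(ltW a0) // ler_wpM2l ?powR_ge0 //.
have -> : a * (x / a) / a = x / a by field; rewrite gt_eqF.
have [y1|y1] := leP (x / a) 1.
  apply: (@le_trans _ _ (1 `^ th)); first by rewrite ge0_ler_powR ?nnegrE.
  by rewrite powR1 lerDl.
by apply: (le_trans (ler1_powR (ltW y1) th1)); rewrite lerDr.
Qed.

(** For $p \le q \le r \le 2$ the norms decrease to the $\ell_r$-norm, where the
    random tensor is estimated by interpolation. *)
Lemma random_dual_le2 (p q r : R) : 1 <= p -> p <= q -> q <= r -> r <= 2 ->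
  exists C0 : R, 0 <= C0 /\ forall n, (0 < n)%N ->
  exists H : {ffun 'I_n * 'I_n * 'I_n -> bool} -> R,
  [/\ forall s, 0 <= H s,
      forall (s : {ffun 'I_n * 'I_n * 'I_n -> bool}) (x y z : 'rV[R]_n),
        tri (fun t => sg R (s t)) (x 0) (y 0) (z 0) <=
        H s * (lpnorm p%:E x * lpnorm q%:E y * lpnorm r%:E z) &
      avg H <= C0 * Num.sqrt (n ^ 3)%:R / (n%:R `^ r^-1 * Num.sqrt n%:R)].
Proof.
move=> p1 pq qr r2.
have r1 : 1 <= r by lra.
have r0 : 0 < r by lra.
have r12 : 1 <= r <= 2 by rewrite r1.
have [C [C_ge0 hC]] := interpolation r12.
have [C2 [C20 hC2]] := @random_trilinear R.
pose th : R := 2 * (1 - r^-1).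
have ri1 : r^-1 <= 1 by rewrite invf_le1.
have ri2 : 2^-1 <= r^-1 by rewrite lef_pV2 ?posrE.
have th0 : 0 <= th by rewrite /th; lra.
have th1 : th <= 1 by rewrite /th; lra.
exists (C * (2 + C2)); split; first by rewrite mulr_ge0 ?addr_ge0.
move=> n n0; have [H2 [H20 triH2 avgH2]] := hC2 n n0.
have N1 : 1 <= n%:R :> R by rewrite ler1n.
have N0 : 0 < n%:R :> R by rewrite ltr0n.
set w := Num.sqrt n%:R : R in avgH2 *.
have w0 : 0 < w by rewrite sqrtr_gt0.
have ww : w ^+ 2 = n%:R by rewrite sqr_sqrtr // ltW.
have w1 : 1 <= w by rewrite -ler_sqr ?nnegrE ?(ltW w0) // ww expr1n.
exists (fun s => C * Num.max 1 (H2 s) `^ th); split.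
- by move=> s; rewrite mulr_ge0 ?powR_ge0.
- move=> s x y z.
  have hS t : `|sg R (s t)| <= 1 by rewrite /sg normrX normrN1 expr1n.
  apply: le_trans (hC n (fun t => sg R (s t)) (Num.max 1 (H2 s)) hS _ _ (x 0) (y 0) (z 0)) _.
  + by rewrite le_max lexx.
  + move=> a b c; apply: le_trans (triH2 _ _ _ _) _.
    by rewrite !ler_wpM2r ?nrm_ge0 // le_max lexx orbT.
  rewrite -/th !lpnormE; cbv beta.
  apply: ler_wpM2l; first by rewrite mulr_ge0 ?powR_ge0.
  apply: ler_wpM2r; first exact: lpn_ge0.
  by apply: ler_pM; [exact: lpn_ge0|exact: lpn_ge0|apply: le_lpn; lra|apply: le_lpn; lra].
have c0 : (0 < #|{: {ffun 'I_n * 'I_n * 'I_n -> bool}}|)%N.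
  by rewrite card_ffun expn_gt0 card_bool.
rewrite avgZ sqrt_cube -/w.
have -> : C * (2 + C2) * (n%:R * w) / (n%:R `^ r^-1 * w) =
   C * ((n%:R / n%:R `^ r^-1) * (2 + C2)).
  by field; rewrite ?gt_eqF ?powR_gt0.
rewrite ler_wpM2l //.
have -> : n%:R / n%:R `^ r^-1 = w `^ th.
  rewrite -[X in X / _]powRr1 ?(ltW N0) // -powRB; last by rewrite (gt_eqF N0) implybT.
  by rewrite /th powRrM powR_mulrn ?(ltW w0) // ww.
apply: (@le_trans _ _ (avg (fun s : {ffun 'I_n * 'I_n * 'I_n -> bool} =>
    w `^ th * (1 + (w^-1 * 1 + w^-1 * H2 s))))).
  apply: avg_le => s; apply: le_trans (powR_le_linear w0 _ th0 th1) _.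
    by rewrite le_max ler01.
  rewrite ler_wpM2l ?powR_ge0 // lerD2l -mulrDr mulrC ler_wpM2l ?invr_ge0 ?(ltW w0) //.
  by rewrite ge_max lerDl H20 lerDr ler01.
rewrite avgZ !avgD !avgZ !avg_cst // ler_wpM2l ?powR_ge0 //.
have i1 : w^-1 <= 1 by rewrite invf_le1.
have i2 : w^-1 * avg H2 <= C2 by rewrite mulrC ler_pdivrMr.
by lra.
Qed.

(** For $p \le 2 = q \le r$ the estimate follows from the Euclidean one, given
    the comparison of $\ell_r^n$ with $\ell_2^n$. *)
Lemma random_dual_ge2 (p : R) (r : \bar R) (tau : nat -> R) : 1 <= p -> p <= 2 ->
  (forall n, (0 < n)%N -> 0 < tau n) ->
  (forall n (z : 'rV[R]_n), (0 < n)%N ->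
     nrm (z 0) <= Num.sqrt n%:R / tau n * lpnorm r z) ->
  exists C0 : R, 0 <= C0 /\ forall n, (0 < n)%N ->
  exists H : {ffun 'I_n * 'I_n * 'I_n -> bool} -> R,
  [/\ forall s, 0 <= H s,
      forall (s : {ffun 'I_n * 'I_n * 'I_n -> bool}) (x y z : 'rV[R]_n),
        tri (fun t => sg R (s t)) (x 0) (y 0) (z 0) <=
        H s * (lpnorm p%:E x * lpnorm 2%:E y * lpnorm r z) &
      avg H <= C0 * Num.sqrt (n ^ 3)%:R / (tau n * Num.sqrt n%:R)].
Proof.
move=> p1 p2 tau0 htau.
have [C2 [C20 hC2]] := @random_trilinear R.
exists C2; split => // n n0; have [H2 [H20 triH2 avgH2]] := hC2 n n0.
have t0 := tau0 n n0.
have N0 : 0 < n%:R :> R by rewrite ltr0n.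
have w0 : 0 < Num.sqrt n%:R :> R by rewrite sqrtr_gt0.
have c0 : 0 <= Num.sqrt n%:R / tau n by rewrite divr_ge0 ?(ltW w0) ?(ltW t0).
exists (fun s => Num.sqrt n%:R / tau n * H2 s); split.
- by move=> s; rewrite mulr_ge0.
- move=> s x y z; apply: le_trans (triH2 _ _ _ _) _.
  have comm (c h a b d : R) : c * h * (a * b * d) = h * a * b * (c * d) by ring.
  rewrite [leRHS]comm.
  apply: ler_pM; rewrite ?mulr_ge0 ?nrm_ge0 //; last exact: htau.
  rewrite lpnorm2E ler_wpM2r ?nrm_ge0 // ler_wpM2l // lpnormE -lpn2E.
  by apply: le_lpn; lra.
rewrite avgZ sqrt_cube.
apply: le_trans (ler_wpM2l c0 avgH2) _.
have ww : n%:R = Num.sqrt n%:R ^+ 2 :> R by rewrite sqr_sqrtr // ltW.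
move: ww w0; set w := Num.sqrt n%:R => -> w0.
by rewrite le_eqVlt; apply/orP; left; apply/eqP; field; rewrite !gt_eqF.
Qed.

(** The comparison of $\ell_r^n$ with $\ell_2^n$ for $r \ge 2$, possibly
    infinite; [tau n] is $n^{1/r}$, the norm of the sign vectors. *)
Lemma lpnorm_ge2 (r : \bar R) : (2%:E <= r)%E ->
  exists tau : nat -> R,
  [/\ forall n, (0 < n)%N -> 0 < tau n,
      forall n (z : 'rV[R]_n), (0 < n)%N ->
        nrm (z 0) <= Num.sqrt n%:R / tau n * lpnorm r z &
      forall n (s : {ffun 'I_n -> bool}), lpnorm r (\row_k sg R (s k)) <= tau n].
Proof.
case: r => [r| |] //.
  rewrite lee_fin => r2; have r0 : 0 < r by lra.
  exists (fun n => n%:R `^ r^-1); split.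
  - by move=> n n0; rewrite powR_gt0 // ltr0n.
  - move=> n z n0; rewrite -lpn2E.
    have := power_mean (z 0) n0 (ltr0n R 2) r2.
    by rewrite powR12_sqrt.
  - move=> n s; rewrite lpnormE -(lpn_sign s r0).
    by rewrite (@eq_lpn R n r _ (fun i => sg R (s i))) // => i; rewrite mxE.
move=> _; exists (fun=> 1); split => //.
- move=> n z n0; rewrite divr1 /lpnorm; set M := \big[_/_]_(i < n) _.
  have zM i : `|z 0 i| <= M by apply: (le_bigmax _ (fun i => `|z 0 i|)).
  have M0 : 0 <= M by apply: le_trans (zM (Ordinal n0)).
  apply: nrm_le; first by rewrite mulr_ge0 ?sqrtr_ge0.
  rewrite exprMn sqr_sqrtr // mulr_natl -[n in leRHS]card_ord -sumr_const.
  apply: ler_sum => i _; rewrite -[leLHS]real_normK ?num_real //.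
  by rewrite lerXn2r ?nnegrE.
- move=> n s; apply: bigmax_le => // i _.
  by rewrite mxE /sg normrX normrN1 expr1n.
Qed.

End DualTensors.

Theorem mainTheorem2 (R : realType) (p q r : \bar R) :
  [/\ 1 <= p, p <= q, q <= r & r <= 2%:E]%E
  \/ [/\ 1 <= p, p <= 2%:E, q = 2%:E & 2%:E <= r]%E ->
  exists C : R, forall n : nat,
    exists E F : {vspace tensor3 R n},
      [/\ forall A B : tensor3 R n, A \in E -> B \in F -> tensor_dot A B = 0,
          \dim E = ((n ^ 3)./2)%N,
          \dim F = uphalf (n ^ 3),
          (dist_to_euclidean p q r E <= C%:E)%E
        & (dist_to_euclidean p q r F <= C%:E)%E].
Proof.
move=> hyp.
suff [C0 [C00 [rho [rho0 [upper dual]]]]] : exists C0 : R, 0 <= C0 /\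
    exists rho : nat -> R, (forall n, (0 < n)%N -> 0 < rho n) /\
    ((forall n (A : tensor3 R n), (0 < n)%N -> projnorm p q r A <= rho n * nrm A) /\
    forall n, (0 < n)%N -> exists H : {ffun 'I_n * 'I_n * 'I_n -> bool} -> R,
    [/\ forall s, 0 <= H s,
        forall (s : {ffun 'I_n * 'I_n * 'I_n -> bool}) (x y z : 'rV[R]_n),
          tri (fun t => sg R (s t)) (x 0) (y 0) (z 0) <=
          H s * (lpnorm p x * lpnorm q y * lpnorm r z) &
        avg H <= C0 * Num.sqrt (n ^ 3)%:R / rho n]).
  have [C [_ hC]] := kashin_tensor p q r C00.
  exists C => n; have [n0|n0] := posnP n.
    subst n; apply: (hC 0%N 1 (fun=> 0)) => //.
    - move=> A; apply: (@le_trans _ _ 0); last by rewrite mul1r nrm_ge0.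
      apply: le_trans (@projnorm_le_sum R 0 p q r 'I_0 (fun=> 0) (fun=> 0) (fun=> 0) A _) _.
        by apply/ffunP => -[[[]]].
      by rewrite big_ord0.
    - by move=> s x y z; rewrite mul0r /tri big1 // => -[[[]]].
    - by rewrite /avg big1 // mul0r divr1 mulr_ge0 ?sqrtr_ge0.
  have [H [H0 triH avgH]] := dual n n0.
  by apply: (hC n (rho n) H) => // [|A]; [apply: rho0|apply: upper].
have s0 n : (0 < n)%N -> 0 < Num.sqrt n%:R :> R by move=> n0; rewrite sqrtr_gt0 ltr0n.
case: hyp => [[]|[]].
  case: p => [p| |] //; case: q => [q| |] //; case: r => [r| |] //.
  rewrite !lee_fin => p1 pq qr r2.
  have [C0 [C00 dual]] := random_dual_le2 p1 pq qr r2.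
  exists C0; split => //; exists (fun n => n%:R `^ r^-1 * Num.sqrt n%:R); split.
    by move=> n n0; rewrite mulr_gt0 ?s0 // powR_gt0 // ltr0n.
  split => // n A n0; apply: projnorm_le_fibres => //; rewrite ?lee_fin; lra.
case: p => [p| |] //; rewrite !lee_fin => p1 p2 -> r2.
have [tau [tau0 tauz taus]] := lpnorm_ge2 r2.
have [C0 [C00 dual]] := random_dual_ge2 p1 p2 tau0 tauz.
exists C0; split => //; exists (fun n => tau n * Num.sqrt n%:R); split.
  by move=> n n0; rewrite mulr_gt0 ?s0 ?tau0.
split => // n A n0; apply: projnorm_le_signs => //; first by rewrite ltW ?tau0.
Qed.
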